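(* There is a linear-time algorithm that, given a block graph $G$, decides whether $G$ has a spanning even tree, and, if it does, computes a spanning even tree of $G$.
   Context: All graphs are finite and simple. A block graph is a graph in which every biconnected component induces a clique. A leaf of a tree is a vertex of degree $1$. A tree is even if for every pair of distinct leaves, the number of edges of the unique path between them is even; a spanning even tree of $G$ is a spanning tree of $G$ that is even. Linear time means time $O(|V(G)|+|E(G)|)$. *)

(* Defs.v *)
From mathcomp Require Import all_boot.

Set Implicit Arguments.
Unset Strict Implicit.
Unset Printing Implicit Defensive.

Record sgraph (V : finType) := SGraph {
  adj :> rel V;
  adj_sym : symmetric adj;
  adj_irr : irreflexive adj }.

Section Graphs.
Variable V : finType.
Implicit Types (G T : sgraph V) (B : {set V}).

Definition edges G : {set {set V}} :=
  [set [set e.1; e.2] | e : V * V & G e.1 e.2].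

Definition induced G B : rel V :=
  [rel x y | [&& x \in B, y \in B & G x y]].

(* The empty set counts as connected here. *)
Definition connected_in G B : bool :=
  [forall x in B, forall y in B, connect (induced G B) x y].

(* [G[B]] is connected and has no cut vertex. A single vertex and the two ends
   of an edge qualify, so that bridges and isolated vertices also give
   biconnected components. *)
Definition biconnected G B : bool :=
  [&& B != set0, connected_in G B & [forall v in B, connected_in G (B :\ v)]].

(* A maximal biconnected subgraph is induced, so it is given by its vertices. *)
Definition biconnected_component G B : bool := maxset (biconnected G) B.

Definition clique G B : Prop := {in B &, forall x y, x != y -> G x y}.

Definition block_graph G : Prop :=
  forall B, biconnected_component G B -> clique G B.

(* [ucycle] also accepts the sequence [:: x; y] for an edge xy, which is not a
   cycle of the graph. *)
Definition acyclic T : Prop := forall c : seq V, ucycle T c -> size c <= 2.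

Definition tree T : Prop :=
  [/\ 0 < #|V|, connected_in T [set: V] & acyclic T].

Definition degree G x : nat := #|[set y | G x y]|.

Definition leaf T x : bool := degree T x == 1.

(* The path x :: p has size p edges. *)
Definition even_tree T : Prop :=
  tree T /\
  forall x y p, leaf T x -> leaf T y -> x != y ->
    path T x p -> last x p = y -> uniq (x :: p) -> ~~ odd (size p).

Definition spanning_even_tree G T : Prop := subrel T G /\ even_tree T.

End Graphs.

(* A random access machine, presented as a structured language with finitely
   many registers and finitely many arrays per program, all holding natural
   numbers. Every operation has unit cost. Comparisons return 0 or 1, and the
   only other operation that can produce a value larger than its arguments is
   the successor: in time t all values are at most the largest input value or
   program constant plus t, so a linear-time program only handles words of
   logarithmic length, and charging one unit per operation is legitimate. *)

Inductive expr :=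
  | Const of nat
  | Reg of nat
  | Read of nat & expr
  | Succ of expr
  | Sub of expr & expr
  | Lt of expr & expr
  | Eq of expr & expr.

Inductive com :=
  | Skip
  | Assign of nat & expr
  | Write of nat & expr & expr
  | Seq of com & com
  | If of expr & com & com
  | While of expr & com.

Record state := State { regs : nat -> nat; mem : nat -> nat -> nat }.

Definition update (A : Type) (f : nat -> A) (i : nat) (a : A) : nat -> A :=
  fun j => if j == i then a else f j.

Definition set_reg (s : state) (x v : nat) : state :=
  State (update (regs s) x v) (mem s).

Definition set_mem (s : state) (a i v : nat) : state :=
  State (regs s) (update (mem s) a (update (mem s a) i v)).

Fixpoint eval (s : state) (e : expr) : nat :=
  match e with
  | Const k => k
  | Reg x => regs s x
  | Read a e1 => mem s a (eval s e1)
  | Succ e1 => (eval s e1).+1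
  | Sub e1 e2 => eval s e1 - eval s e2
  | Lt e1 e2 => eval s e1 < eval s e2
  | Eq e1 e2 => eval s e1 == eval s e2
  end.

Fixpoint cost (e : expr) : nat :=
  match e with
  | Const _ | Reg _ => 1
  | Read _ e1 | Succ e1 => (cost e1).+1
  | Sub e1 e2 | Lt e1 e2 | Eq e1 e2 => (cost e1 + cost e2).+1
  end.

(* [exec p s t s']: started in s, the program p halts in s' after t steps. In
   tests, 0 is false and any other value is true. *)
Inductive exec : com -> state -> nat -> state -> Prop :=
  | ExecSkip s : exec Skip s 1 s
  | ExecAssign s x e :
      exec (Assign x e) s (cost e).+1 (set_reg s x (eval s e))
  | ExecWrite s a e1 e2 :
      exec (Write a e1 e2) s (cost e1 + cost e2).+1
           (set_mem s a (eval s e1) (eval s e2))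
  | ExecSeq p1 p2 s1 s2 s3 t1 t2 :
      exec p1 s1 t1 s2 -> exec p2 s2 t2 s3 ->
      exec (Seq p1 p2) s1 (t1 + t2).+1 s3
  | ExecIfTrue e p1 p2 s s' t :
      eval s e != 0 -> exec p1 s t s' ->
      exec (If e p1 p2) s (cost e + t).+1 s'
  | ExecIfFalse e p1 p2 s s' t :
      eval s e = 0 -> exec p2 s t s' ->
      exec (If e p1 p2) s (cost e + t).+1 s'
  | ExecWhileTrue e p s1 s2 s3 t1 t2 :
      eval s1 e != 0 -> exec p s1 t1 s2 -> exec (While e p) s2 t2 s3 ->
      exec (While e p) s1 (cost e + t1 + t2).+1 s3
  | ExecWhileFalse e p s :
      eval s e = 0 -> exec (While e p) s (cost e).+1 s.

Section InputOutput.
Variable n : nat.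

(* The neighbours of each vertex, each once, in an arbitrary order. *)
Definition adjacency_lists (G : sgraph 'I_n) (L : 'I_n -> seq 'I_n) : Prop :=
  forall v, uniq (L v) /\ L v =i G v.

(* Register 0 holds n. Array 1 holds the concatenation of the adjacency lists
   of the vertices 0, ..., n-1; the list of v occupies the positions from
   offset v (included) to offset v+1 (excluded), where the offsets
   0, ..., n are held by array 0. Everything else is 0. *)
Definition offsets (L : 'I_n -> seq 'I_n) : seq nat :=
  mkseq (fun i => \sum_(v < n | v < i) size (L v)) n.+1.

Definition neighbours (L : 'I_n -> seq 'I_n) : seq nat :=
  [seq val w | w <- flatten [seq L v | v <- enum 'I_n]].

Definition input (L : 'I_n -> seq 'I_n) : state :=
  State (fun x => if x == 0 then n else 0)
        (fun a => if a == 0 then nth 0 (offsets L)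
                  else if a == 1 then nth 0 (neighbours L)
                  else fun=> 0).

(* The answer is "no" if register 0 holds 0. Otherwise it is "yes", register 1
   holds the number of edges of the computed tree, and the two ends of its
   edges are listed by arrays 2 and 3. *)
Definition output (s : state) : option (seq (nat * nat)) :=
  if regs s 0 == 0 then None
  else Some [seq (mem s 2 i, mem s 3 i) | i <- iota 0 (regs s 1)].

(* es lists every edge of T exactly once, with its ends in either order. *)
Definition edge_list (T : sgraph 'I_n) (es : seq (nat * nat)) : Prop :=
  exists l : seq ('I_n * 'I_n),
    let ends := [seq [set e.1; e.2] | e <- l] in
    [/\ es = [seq (val e.1, val e.2) | e <- l], uniq ends & ends =i edges T].

End InputOutput.

(* Main.v *)
Require Import Defs.
From mathcomp Require Import all_boot zify.

Set Implicit Arguments.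
Unset Strict Implicit.
Unset Printing Implicit Defensive.

(* A tree is even iff, in its proper 2-colouring, all leaves have the same
   colour, say [false]. In a block graph, a spanning even tree exists iff the
   vertices have a 2-colouring in which no block is monochromatic and the
   vertices of degree 1 have colour [false]; a colouring of this kind may have
   to be changed before a tree can be read off it.

   Breadth-first search from vertex 0 reveals the blocks: every cycle induces
   a clique, so two adjacent vertices neither of which is the parent of the
   other have the same parent, and a block consists of a vertex and a class of
   mutually adjacent children of it. Going through the vertices in reverse
   order, the algorithm computes the colours forced by the subtrees: vertices
   of degree 1 are forced to be [false], and otherwise a vertex is forced to
   be [true] (resp. [false]) if in some block below it no child may be [true]
   (resp. [false]). If no vertex is forced both ways, the vertices are
   coloured in search order: forced colours are respected, the other vertices
   get [false], except that one child of a block becomes [true] if the parent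
   is [false] and no child is forced to be [true]. Each vertex is then
   attached to its parent if their colours differ, and otherwise to a fixed
   child in the same block that has the colour opposite to that of the parent.
   *)

(** * Executing programs *)

Fixpoint loop_free (p : com) : bool :=
  match p with
  | Seq p1 p2 | If _ p1 p2 => loop_free p1 && loop_free p2
  | While _ _ => false
  | _ => true
  end.

Fixpoint run (p : com) (s : state) : state :=
  match p with
  | Assign x e => set_reg s x (eval s e)
  | Write a e1 e2 => set_mem s a (eval s e1) (eval s e2)
  | Seq p1 p2 => run p2 (run p1 s)
  | If e p1 p2 => if eval s e == 0 then run p2 s else run p1 s
  | _ => s
  end.

(** Both branches of a conditional are charged, so that the bound depends on the program alone. *)
Fixpoint max_cost (p : com) : nat :=
  match p with
  | Assign _ e => (cost e).+1
  | Write _ e1 e2 => (cost e1 + cost e2).+1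
  | Seq p1 p2 => (max_cost p1 + max_cost p2).+1
  | If e p1 p2 => (cost e + (max_cost p1 + max_cost p2)).+1
  | _ => 1
  end.

Lemma run_if e p1 p2 s :
  run (If e p1 p2) s = if eval s e == 0 then run p2 s else run p1 s.
Proof. by []. Qed.

Lemma exec_loop_free p s :
  loop_free p -> exists2 t, exec p s t (run p s) & t <= max_cost p.
Proof.
elim: p s => [|x e|a e1 e2|p1 IH1 p2 IH2|e p1 IH1 p2 IH2|//] s /=.
- by exists 1 => //; constructor.
- by exists (cost e).+1 => //; constructor.
- by exists (cost e1 + cost e2).+1 => //; constructor.
- case/andP=> /(IH1 s) [t1 X1 le1] /(IH2 (run p1 s)) [t2 X2 le2].
  by exists (t1 + t2).+1; [exact: ExecSeq X1 X2 | lia].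
- case/andP=> /(IH1 s) [t1 X1 le1] /(IH2 s) [t2 X2 le2].
  case: eqP => [e0 | /eqP e0].
    by exists (cost e + t2).+1; [exact: ExecIfFalse | lia].
  by exists (cost e + t1).+1; [exact: ExecIfTrue | lia].
Qed.

Definition while_cost e p := cost e + max_cost p + 1.

(** The number [m] is a potential lowered by every iteration. The body is loop-free, so an iteration
    has bounded cost; [m.+1] also pays for the final failing test. *)
Lemma exec_while (I : nat -> state -> Prop) e p m s :
    loop_free p ->
    (forall m s, I m s -> eval s e != 0 ->
       exists2 m', m' < m & I m' (run p s)) ->
    I m s ->
  exists t s' m',
    [/\ exec (While e p) s t s', t <= while_cost e p * m.+1, I m' s'
      & eval s' e = 0].
Proof.
move=> lf_p step; elim/ltn_ind: m s => m IH s Is.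
have [e0 | e_neq0] := eqVneq (eval s e) 0.
  exists (cost e).+1, s, m; split=> //; first exact: ExecWhileFalse.
  by rewrite /while_cost; nia.
have [m' lt_m' Is'] := step m s Is e_neq0.
have [t1 X1 le1] := exec_loop_free s lf_p.
have [t [s' [m'' [X le_t Is'' e0]]]] := IH m' lt_m' _ Is'.
exists (cost e + t1 + t).+1, s', m''; split=> //; first exact: ExecWhileTrue X1 X.
by move: le_t; rewrite /while_cost; nia.
Qed.

(** * Cycles of block graphs *)

Section Cycles.
Variable V : finType.
Implicit Types (G : sgraph V) (B : {set V}).

Lemma connected_in_path G x s : path G x s -> connected_in G [set y in x :: s].
Proof.
move=> G_s; set B := [set y in x :: s].
have symB : connect_sym (induced G B).
  by apply: sym_connect_sym => a b; rewrite /induced /= adj_sym andbCA.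
have Bs : path (induced G B) x s.
  have sub_B : {in B &, subrel G (induced G B)}.
    by move=> a b aB bB Gab; rewrite /induced /= aB bB.
  have all_B : all [in B] (x :: s) by apply/allP => y ys /=; rewrite inE.
  exact: sub_in_path sub_B _ _ all_B G_s.
have conn_x y : y \in B -> connect (induced G B) x y.
  by rewrite inE => ys; apply: path_connect Bs _ _.
apply/forall_inP => y yB; apply/forall_inP => z zB.
by apply: connect_trans (conn_x z zB); rewrite symB conn_x.
Qed.

(** Deleting a vertex of a cycle leaves a path, which is connected. *)
Lemma cycle_biconnected G c :
  ucycle G c -> 2 < size c -> biconnected G [set x in c].
Proof.
case/andP=> cyc_c uniq_c sz_c; apply/and3P; split.
- by case: c sz_c {cyc_c uniq_c} => // x c _; apply/set0Pn; exists x; rewrite !inE eqxx.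
- case: c cyc_c {uniq_c sz_c} => [_ | x c].
    by apply/forall_inP => y; rewrite !inE.
  by rewrite /= rcons_path => /andP[+ _]; apply: connected_in_path.
apply/forall_inP => v; rewrite inE => v_c.
have [i s def_c] := rot_to v_c.
have mem_c : c =i v :: s by move=> x; rewrite -def_c mem_rot.
have: uniq (v :: s) by rewrite -def_c rot_uniq.
have: cycle G (v :: s) by rewrite -def_c rot_cycle.
have: 2 < size (v :: s) by rewrite -def_c size_rot.
case: s mem_c {def_c} => //= y s mem_c _ /andP[_].
rewrite rcons_path => /andP[Gs _] /andP[vs _].
have -> : [set x in c] :\ v = [set x in y :: s].
  apply/setP => x; rewrite !inE mem_c !inE; case: eqP => //= -> .
  by move: vs; rewrite inE => /negPf->.
exact: connected_in_path.
Qed.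

(** A cycle extends to a biconnected component, which is a clique. *)
Lemma block_graph_cycle G c :
    block_graph G -> ucycle G c -> 2 < size c ->
  {in c &, forall x y, x != y -> G x y}.
Proof.
move=> bG cyc_c sz_c x y xc yc.
have [B maxB sub_cB] := maxset_exists (cycle_biconnected cyc_c sz_c).
by apply: (bG B maxB); apply: (subsetP sub_cB); rewrite inE.
Qed.

Lemma root_rank_min (r : V) (p : V -> V) (idx : V -> nat) v :
  (forall v, v != r -> idx (p v) < idx v) -> idx r <= idx v.
Proof.
move=> idx_p; have [k] := ubnP (idx v); elim: k v => // k IH v le_k.
have [-> // | /idx_p lt_p] := eqVneq v r.
by apply: leq_trans (ltnW lt_p); apply: IH; lia.
Qed.

(* The path is the one through the nearest common ancestor [z]. *)
Lemma ancestor_path (e : rel V) (r : V) (p : V -> V) (idx : V -> nat) x y :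
    injective idx -> symmetric e ->
    (forall v, v != r -> e v (p v) /\ idx (p v) < idx v) ->
  exists s z,
    [/\ path e x s, last x s = y, uniq (x :: s) &
     [/\ z \in x :: s, (x != z -> p x \in x :: s), (y != z -> p y \in x :: s) &
       forall u, u \in x :: s -> idx z <= idx u <= maxn (idx x) (idx y)]].
Proof.
move=> idx_inj e_sym pP.
(* Induction on the sum of the indices: the end of larger index is moved to its parent, and its
   index exceeds all those on the shorter path. *)
have [m] := ubnP (idx x + idx y); elim: m x y => // m IH x y le_m.
have root_min v : idx r <= idx v by apply: (root_rank_min (p := p)) => u /pP[].
case: (ltngtP (idx x) (idx y)) => [lt_xy | lt_yx | /idx_inj <-].
- have /pP[e_y lt_y] : y != r.
    by apply/eqP => y_r; have := root_min x; rewrite -y_r; lia.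
  have [|s [z [s_path s_last s_uniq [zs xz yz bound]]]] := IH x (p y).
    by lia.
  have le_u u : u \in x :: s -> idx z <= idx u < idx y.
    by move/bound; move: lt_xy lt_y; clear; lia.
  have ys : y \notin x :: s by apply/negP => /le_u; clear; lia.
  exists (rcons s y), z; rewrite -rcons_cons; split.
  + by rewrite rcons_path s_path s_last e_sym.
  + by rewrite last_rcons.
  + by rewrite rcons_uniq ys.
  split; rewrite ?mem_rcons ?[_ \in y :: _]in_cons.
  + by rewrite zs orbT.
  + by move/xz => ->; rewrite orbT.
  + by move=> _; apply/orP; right; rewrite -s_last mem_last.
  move=> u; rewrite mem_rcons inE => /orP[/eqP-> | /le_u]; last by clear; lia.
  by have /le_u := zs; clear; lia.
- have /pP[e_x lt_x] : x != r.
    by apply/eqP => x_r; have := root_min y; rewrite -x_r; lia.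
  have [|s [z [s_path s_last s_uniq [zs xz yz bound]]]] := IH (p x) y.
    by lia.
  have le_u u : u \in p x :: s -> idx z <= idx u < idx x.
    by move/bound; move: lt_yx lt_x; clear; lia.
  have xs : x \notin p x :: s by apply/negP => /le_u; clear; lia.
  exists (p x :: s), z; split=> //.
  + by rewrite /= e_x.
  + by rewrite cons_uniq xs.
  split; rewrite ?[_ \in x :: _ :: _]in_cons.
  + by rewrite zs orbT.
  + by rewrite inE eqxx orbT.
  + by move/yz => ->; rewrite orbT.
  move=> u; rewrite in_cons => /orP[/eqP-> | /le_u]; last by clear; lia.
  by have /le_u := zs; clear; lia.
- exists [::], x; split=> //; split; rewrite ?inE ?eqxx // => u.
  by rewrite inE => /eqP->; rewrite leqnn.
Qed.

(** The edge [xy] closes the tree path between its ends; the last two hypotheses say that it is not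
    a parent edge. The vertex [z] is the nearest common ancestor. *)
Lemma fundamental_cycle (e : rel V) (r : V) (p : V -> V) (idx : V -> nat) x y :
    injective idx -> symmetric e ->
    (forall v, v != r -> e v (p v) /\ idx (p v) < idx v) ->
    x != y -> e x y -> (x == r) || (p x != y) -> (y == r) || (p y != x) ->
  exists c z,
    [/\ ucycle e c, 2 < size c, z \in c &
     [/\ x \in c, y \in c, (x != z -> p x \in c), (y != z -> p y \in c) &
       forall u, u \in c -> idx z <= idx u]].
Proof.
move=> idx_inj e_sym pP neq_xy e_xy px py.
have [s [z [s_path s_last s_uniq [zs xz yz bound]]]] :=
  ancestor_path x y idx_inj e_sym pP.
have ys : y \in x :: s by rewrite -s_last mem_last.
(* The root has the least index, so it is the nearest common ancestor as soon as it lies on the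
   path. *)
have root_z v : v = r -> v \in x :: s -> v = z.
  move=> v_r /bound/andP[le_zv _]; apply/eqP/negPn/negP => neq_vz.
  have [|_] := pP z; first by rewrite -v_r eq_sym.
  have root_min w : idx r <= idx w by apply: (root_rank_min (p := p)) => u /pP[].
  suff: idx z != idx v by move: le_zv (root_min z); rewrite -v_r; clear; lia.
  by rewrite (inj_eq idx_inj) eq_sym.
(* [ucycle] also accepts a single edge, so a third vertex must be exhibited; the parent of [x] or of
   [y] will serve. *)
have third w : w \in x :: s -> w != x -> w != y -> 2 < size (x :: s).
  move=> ws wx wy; have: uniq [:: w; x; y] by rewrite /= !inE negb_or wx wy neq_xy.
  move/uniq_leq_size; apply=> u; rewrite !inE => /or3P[] /eqP-> //.
  by rewrite eqxx.
exists (x :: s), z; split=> //.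
- by rewrite /ucycle s_uniq /= rcons_path s_path s_last e_sym e_xy.
- have p_neq v : v != r -> p v != v.
    by move=> /pP[_]; apply: contraTneq => ->; rewrite ltnn.
  have [x_z | neq_xz] := eqVneq x z.
    have y_z : y != z by rewrite -x_z eq_sym.
    have y_r : y != r by apply: contra_neq y_z => /root_z ->.
    by apply: (third (p y)); rewrite ?yz ?p_neq //; move: py; rewrite (negPf y_r).
  have x_r : x != r by apply: contra_neq neq_xz => /root_z ->; rewrite ?inE ?eqxx.
  by apply: (third (p x)); rewrite ?xz ?p_neq //; move: px; rewrite (negPf x_r).
- by split; rewrite ?inE ?eqxx // => u /bound /andP[].
Qed.

End Cycles.

(** * Trees and their 2-colourings *)

Section Trees.
Variable V : finType.
Implicit Types (G T : sgraph V) (chi : V -> bool).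

Lemma connected_in_setT G :
  connected_in G [set: V] <-> forall x y, connect G x y.
Proof.
have eqG : connect (induced G [set: V]) =2 connect G.
  by apply: eq_connect => x y; rewrite /induced /= !inE.
split=> [conn x y | conn].
  by move/forall_inP/(_ x (in_setT x))/forall_inP/(_ y (in_setT y)): conn; rewrite eqG.
by apply/forall_inP => x _; apply/forall_inP => y _; rewrite eqG.
Qed.

Lemma connect_exit (e : rel V) (D : pred V) x y :
  connect e x y -> D x -> ~~ D y -> exists u w, [/\ D u, ~~ D w & e u w].
Proof.
case/connectP => s; elim: s x => [|w s IH] x /= => [_ -> -> //|].
case/andP=> exw es ly Dx NDy; have [Dw|NDw] := boolP (D w); first exact: IH es ly Dw NDy.
by exists x, w.
Qed.

Definition parent_rel (r : V) (q : V -> V) : rel V :=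
  [rel x y | (x != r) && (q x == y) || (y != r) && (q y == x)].

(** Ranks decrease along [q] down to the root, which gives connectedness. On a cycle, both
    neighbours of a vertex of maximal rank would be its parent, which excludes cycles. *)
Lemma parent_tree (r : V) (q : V -> V) (rk : V -> nat) :
    (forall v, v != r -> rk (q v) < rk v) ->
  exists2 T : sgraph V, T =2 parent_rel r q & tree T.
Proof.
move=> rkP.
have symT : symmetric (parent_rel r q) by move=> x y; rewrite /parent_rel /= orbC.
have irrT : irreflexive (parent_rel r q).
  move=> x; rewrite /parent_rel /= orbb; apply/negP => /andP[/rkP lt_x /eqP q_x].
  by rewrite q_x ltnn in lt_x.
exists (SGraph symT irrT) => //; split; first by apply/card_gt0P; exists r.
- have conn_r x : connect (parent_rel r q) x r.
    have [m] := ubnP (rk x); elim: m x => // m IH x lt_m.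
    have [-> // | x_r] := eqVneq x r.
    have /IH : rk (q x) < m by have := rkP x x_r; lia.
    by apply: connect_trans; apply: connect1; rewrite /parent_rel /= x_r eqxx.
  apply/connected_in_setT => x y; apply: connect_trans (conn_r x) _.
  by rewrite sym_connect_sym // conn_r.
move=> c /andP[cyc_c uniq_c]; rewrite leqNgt; apply/negP => sz_c.
have [x0 x0c] : exists x, x \in c.
  by case: c sz_c {cyc_c uniq_c} => // x c; exists x; rewrite mem_head.
have [x xc max_x] := arg_maxnP rk (x0c : mem c x0).
have nbr_x y : parent_rel r q x y -> y \in c -> y = q x.
  case/orP => /andP[+ /eqP q_y] yc; first by [].
  by move/rkP; rewrite q_y => lt_y; have := max_x y yc; rewrite /= in lt_y *; lia.
have [i s def_c] := rot_to xc.
have: uniq (x :: s) by rewrite -def_c rot_uniq.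
have: cycle (parent_rel r q) (x :: s) by rewrite -def_c rot_cycle.
have: 2 < size (x :: s) by rewrite -def_c size_rot.
have mem_c y : y \in x :: s -> y \in c by rewrite -def_c mem_rot.
case: s mem_c {def_c} => // y s mem_c sz_s cyc_s uniq_s.
move: cyc_s; rewrite /cycle rcons_path => /andP[/andP[x_y _] l_x].
have y_q : y = q x by apply: nbr_x x_y (mem_c _ _); rewrite !inE eqxx orbT.
have l_q : last x (y :: s) = q x.
  by apply: nbr_x; [rewrite symT | apply: mem_c; rewrite mem_last].
case/lastP: s sz_s l_q uniq_s {mem_c l_x} => // s z _.
rewrite last_cons last_rcons -y_q => ->.
by rewrite !cons_uniq mem_rcons !inE eqxx andbF.
Qed.

(** The colour is the parity of the distance [d] from [r]. Each vertex other than [r] has a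
    neighbour one step closer; an edge not of this form would lie on a fundamental cycle. *)
Lemma tree_coloring T : tree T -> exists chi, forall x y, T x y -> chi x = ~~ chi y.
Proof.
case=> /card_gt0P[r _] /connected_in_setT conn acycT.
pose P v k := [exists s : k.-tuple V, path T r s && (last r s == v)].
have exP v : exists k, P v k.
  have /connectP[s Ts ->] := conn r v.
  by exists (size s); apply/existsP; exists (in_tuple s); rewrite Ts /=.
pose d v := ex_minn (exP v).
have dP v : P v (d v) by rewrite /d; case: ex_minnP.
have d_min v s : path T r s -> last r s = v -> d v <= size s.
  rewrite /d; case: ex_minnP => m _ le_m Ts l_v; apply: le_m.
  by apply/existsP; exists (in_tuple s); rewrite Ts l_v /=.
have /fin_all_exists[p pP] : forall v, exists u, v != r -> T v u /\ d v = (d u).+1.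
  move=> v; have [v_r | v_r] := eqVneq v r; first by exists r.
  have /existsP[[s /= /eqP sz_s] /andP[Ts /eqP l_v]] := dP v.
  case/lastP: s => [|s w] in sz_s Ts l_v.
    by rewrite -l_v eqxx in v_r.
  rewrite last_rcons in l_v; rewrite {w}l_v rcons_path in sz_s Ts.
  case/andP: Ts => Ts T_v; exists (last r s) => _; split; first by rewrite adj_sym.
  have le_s := d_min _ _ Ts erefl; rewrite size_rcons in sz_s.
  have /existsP[[s' /= /eqP sz_s'] /andP[Ts' /eqP l_s']] := dP (last r s).
  have := d_min v (rcons s' v); rewrite rcons_path Ts' l_s' T_v last_rcons size_rcons.
  by move=> /(_ isT erefl); lia.
(* Ties of distance are broken by the enumeration, since [fundamental_cycle] asks for injective
   indices. *)
pose idx v := d v * #|V| + enum_rank v.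
have idx_inj : injective idx.
  move=> u v eq_uv; apply: enum_rank_inj; apply: val_inj => /=.
  have := congr1 (modn^~ #|V|) eq_uv.
  by rewrite !modnMDl !modn_small.
have p_idx v : v != r -> T v (p v) /\ idx (p v) < idx v.
  case/pP => Tv dv; split=> //; rewrite /idx dv mulSnr.
  by rewrite -addnA ltn_add2l ltn_addr // ltn_ord.
exists (fun v => odd (d v)) => x y Txy.
have neq_xy : x != y by apply: contraTneq Txy => ->; rewrite adj_irr.
have [/andP[/pP[_ ->] /eqP->] //| px] := boolP ((x != r) && (p x == y)).
have [/andP[/pP[_ ->] /eqP->] /=| py] := boolP ((y != r) && (p y == x)).
  by rewrite negbK.
rewrite negb_and negbK in px; rewrite negb_and negbK in py.
have [c [z [cyc_c sz_c _ _]]] :=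
  fundamental_cycle idx_inj (@adj_sym _ T) p_idx neq_xy Txy px py.
by have := acycT c cyc_c; rewrite leqNgt sz_c.
Qed.

Lemma path_coloring (e : rel V) chi x s :
    (forall x y, e x y -> chi x = ~~ chi y) -> path e x s ->
  chi (last x s) = chi x (+) odd (size s).
Proof.
move=> chiP; elim: s x => [|y s IH] x /=; first by rewrite addbF.
by case/andP=> /chiP-> /IH->; case: (chi y); case: (odd _).
Qed.

(** In a proper 2-colouring, paths of even length give all leaves one colour; adding the colour of a
    fixed leaf turns it into [false]. *)
Lemma even_tree_coloring T :
    even_tree T ->
  exists chi, (forall x y, T x y -> chi x = ~~ chi y) /\
              (forall x, leaf T x -> chi x = false).
Proof.
move=> [treeT evenT]; have [chi chiP] := tree_coloring treeT.
case: (pickP (leaf T)) => [l leaf_l | no_leaf]; last first.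
  by exists chi; split=> // x; rewrite no_leaf.
exists (fun x => chi x (+) chi l); split=> [x y /chiP-> | x leaf_x].
  by rewrite addNb.
have [-> | neq_xl] := eqVneq x l; first by rewrite addbb.
have [_ /connected_in_setT conn _] := treeT.
have /connectP[s0 /shortenP[s Ts uniq_s _] l_s] := conn x l.
have := evenT x l s leaf_x leaf_l neq_xl Ts (esym l_s) uniq_s.
by rewrite l_s (path_coloring chiP Ts) => /negPf->; rewrite addbF addbb.
Qed.

Lemma coloring_even_tree T chi :
    tree T -> (forall x y, T x y -> chi x = ~~ chi y) ->
    (forall x, leaf T x -> chi x = false) ->
  even_tree T.
Proof.
move=> treeT chiP leafP; split=> // x y s /leafP x0 /leafP y0 _ Ts l_s _.
by move: (path_coloring chiP Ts); rewrite l_s x0 y0 /= => <-.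
Qed.

End Trees.

(* [rho v] names the block through [v] and its parent [p v]. *)
Record block_tree (V : finType) (G : sgraph V) (r : V) (idx : V -> nat)
    (p rho : V -> V) : Prop := BlockTree {
  bt_inj : injective idx;
  bt_root : p r = r;
  bt_parent : forall v, v != r -> G v (p v) /\ idx (p v) < idx v;
  bt_adj : forall v w, G v w ->
    [\/ w != r /\ p w = v, v != r /\ p v = w
      | [/\ v != r, w != r, p v = p w & rho v = rho w]];
  bt_rep : forall v, v != r ->
    [/\ rho v != r, p (rho v) = p v, rho (rho v) = rho v & idx (rho v) <= idx v];
  bt_clique : forall v w, v != r -> w != r -> rho v = rho w -> v != w -> G v w }.

(* Colour [false] is the colour of the leaves. *)
Definition valid_coloring (V : finType) (G : sgraph V) (r : V) (p rho : V -> V)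
    (chi : V -> bool) : Prop :=
  (forall v, v != r -> exists w, [/\ w != r, rho w = rho v & chi w != chi (p v)])
  /\ (forall v, degree G v = 1 -> chi v = false).

Section BlockTree.
Variables (V : finType) (G : sgraph V) (r : V) (idx : V -> nat) (p rho : V -> V).
Hypothesis bt : block_tree G r idx p rho.

(** The tree has to connect the part of the graph below a block to the parent of the block, and this
    takes a tree edge from a child in the block to the parent. *)
Lemma spanning_even_tree_valid T :
  spanning_even_tree G T -> exists chi, valid_coloring G r p rho chi.
Proof.
case=> sub_TG /[dup] evenT [[_ /connected_in_setT conn _] _].
have [chi [chiP leafP]] := even_tree_coloring evenT.
exists chi; split=> [v v_r | v deg_v].
  (* [D] collects the children in the block of [v] and all their descendants. *)
  pose D u := [exists c, [&& c != r, rho c == rho v & fconnect p u c]].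
  have idx_p u : idx (p u) <= idx u.
    have [-> | /(bt_parent bt)[_ /ltnW//]] := eqVneq u r.
    by rewrite (bt_root bt).
  have idx_conn u c : fconnect p u c -> idx c <= idx u.
    case/connectP => s; elim: s u => [|w s IH] u /=; first by move=> _ ->.
    by case/andP=> /eqP<- ps l_s; apply: leq_trans (idx_p u); apply: IH.
  have par_class c : c != r -> rho c = rho v -> p c = p v.
    move=> /(bt_rep bt)[_ <- _ _] ->; by case: (bt_rep bt v_r).
  have Dv : D v by apply/existsP; exists v; rewrite v_r eqxx connect0.
  have D_up u : D u -> D (p u) \/ [/\ u != r, rho u = rho v & p u = p v].
    case/existsP=> c /and3P[c_r /eqP rho_c /connectP[[|w s] /= ps l_s]].
      by right; rewrite -l_s; split=> //; apply: par_class.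
    case/andP: ps => /eqP def_w ps; left; apply/existsP; exists c.
    by rewrite c_r rho_c eqxx def_w; apply/connectP; exists s.
  have D_down u : D (p u) -> D u.
    case/existsP=> c /and3P[c_r rho_c conn_c]; apply/existsP; exists c.
    by rewrite c_r rho_c /=; apply: connect_trans conn_c; apply: fconnect1.
  have ND : ~~ D (p v).
    apply/existsP => -[c /and3P[c_r /eqP rho_c /idx_conn]].
    by rewrite -(par_class c c_r rho_c) leqNgt; case: (bt_parent bt c_r) => _ ->.
  (* By [bt_adj], an edge leaving [D] can only go from a child in the block up to [p v]. *)
  have [u [w [Du NDw Tuw]]] := connect_exit (conn v (p v)) Dv ND.
  case: (bt_adj bt (sub_TG _ _ Tuw)) => [[w_r p_w] | [u_r p_u] | [u_r w_r p_uw rho_uw]].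
  - by case/negP: NDw; apply: D_down; rewrite p_w.
  - case: (D_up u Du) => [|[_ rho_u p_v]]; first by rewrite p_u (negPf NDw).
    exists u; split=> //; rewrite -p_v p_u.
    by rewrite (chiP _ _ Tuw); case: (chi w).
  case: (D_up u Du) => [|[_ rho_u p_v]].
    by rewrite p_uw => /D_down; rewrite (negPf NDw).
  by case/negP: NDw; apply/existsP; exists w; rewrite w_r -rho_uw rho_u eqxx connect0.
(* A vertex of degree 1 in [G] keeps its only edge in the connected graph [T], so it is a leaf. *)
apply: leafP; rewrite /leaf eqn_leq -{1}deg_v; apply/andP; split.
  by apply: subset_leq_card; apply/subsetP => y; rewrite !inE => /sub_TG.
have [w] : exists w, w \in [set y | G v y].
  by apply/card_gt0P; rewrite -/(degree G v) deg_v.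
rewrite inE => Gvw; have neq_vw : v != w by apply: contraTneq Gvw => ->; rewrite adj_irr.
have [||u [u' [/eqP-> _ Tvu]]] := connect_exit (D := pred1 v) (conn v w).
- by rewrite /= eqxx.
- by rewrite /= eq_sym.
by apply/card_gt0P; exists u'; rewrite inE.
Qed.

End BlockTree.

(** * Forced colours *)

Section Labels.
Variables (V : finType) (G : sgraph V) (r : V) (idx : V -> nat) (p rho : V -> V).
Hypothesis bt : block_tree G r idx p rho.
Implicit Types (MA MB : V -> bool) (CA CB : V -> option V) (ok : bool).

(* [MA v] / [MB v]: the subtree of [v] forces the colour [false] / [true] on [v].
   [CA x] / [CB x]: a vertex of the block [x], other than its parent, that may
   receive the colour [false] / [true]. The vertices of index at least [i] have
   contributed to [CA] and [CB], the blocks of index at least [j] to the labels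
   of their parents. *)
Record labels (i j : nat) MA MB CA CB ok : Prop := Labels {
  lab_A : forall chi, valid_coloring G r p rho chi -> forall v, MA v -> chi v = false;
  lab_B : forall chi, valid_coloring G r p rho chi -> forall v, MB v -> chi v = true;
  lab_CA : forall x w, CA x = Some w -> [/\ w != r, i <= idx w, rho w = x & ~~ MB w];
  lab_CB : forall x w, CB x = Some w -> [/\ w != r, i <= idx w, rho w = x & ~~ MA w];
  lab_CA0 : forall v, CA (rho v) = None -> v != r -> i <= idx v -> MB v;
  lab_CB0 : forall v, CB (rho v) = None -> v != r -> i <= idx v -> MA v;
  lab_pref : forall v w, CB (rho v) = Some w -> v != r -> i <= idx v ->
    MB v -> ~~ MA v -> MB w;
  lab_up : forall v, v != r -> j <= idx v -> rho v = v ->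
    (CA v = None -> MA (p v)) /\ (CB v = None -> MB (p v));
  lab_down : forall v, MB v ->
    exists x, [/\ x != r, i <= idx x, rho x = x, p x = v & CB x = None];
  lab_deg : forall v, i <= idx v -> degree G v = 1 -> MA v;
  lab_ok : if ok then forall v, i <= idx v -> ~~ (MA v && MB v)
           else forall chi, ~ valid_coloring G r p rho chi }.

Definition set_at (T : Type) (f : V -> T) (v : V) (a : T) : V -> T :=
  fun u => if u == v then a else f u.

Lemma set_at_true (f : V -> bool) u v : f v -> set_at f u true v.
Proof. by rewrite /set_at; case: eqP. Qed.

(** Labels are written at vertices not yet processed, so what is known of the processed ones
    persists. *)
Lemma set_at_ltn (T : Type) i (f : V -> T) u a v :
  idx u < i -> i <= idx v -> set_at f u a v = f v.
Proof.
move=> lt_u le_v; rewrite /set_at; case: eqP => // v_u.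
by move: lt_u; rewrite -v_u ltnNge le_v.
Qed.

Lemma labels_init i j : (forall v, idx v < i) -> (forall v, idx v < j) ->
  labels i j (fun=> false) (fun=> false) (fun=> None) (fun=> None) true.
Proof.
move=> lt_i lt_j; have not_i v : (i <= idx v) = false by rewrite leqNgt lt_i.
have not_j v : (j <= idx v) = false by rewrite leqNgt lt_j.
by split=> // v; rewrite ?not_i ?not_j.
Qed.

(** The clauses that require [MA] to be absent speak of processed vertices only, so a new mark
    cannot break them. *)
Lemma labels_setA i j MA MB CA CB ok u :
    labels i j MA MB CA CB ok -> idx u < i ->
    (forall chi, valid_coloring G r p rho chi -> chi u = false) ->
  labels i j (set_at MA u true) MB CA CB ok.
Proof.
case=> hA hB hCA hCB hCA0 hCB0 hpref hup hdown hdeg hok lt_u u_A; split=> //.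
- move=> chi valid v; rewrite /set_at; case: eqP => [-> _ | _]; first exact: u_A.
  exact: hA.
- by move=> x w /hCB[w_r le_w rho_w NA]; rewrite (set_at_ltn _ _ lt_u).
- by move=> v C0 v_r le_v; apply/set_at_true/hCB0.
- move=> v w Cw v_r le_v Bv; rewrite (set_at_ltn _ _ lt_u) //; exact: hpref Cw _ _ Bv.
- move=> v v_r le_v rho_v; have [up1 up2] := hup v v_r le_v rho_v.
  by split=> // /up1/set_at_true.
- by move=> v le_v deg_v; apply/set_at_true/hdeg.
case: (ok) hok => // hok v le_v; rewrite (set_at_ltn _ _ lt_u) //; exact: hok.
Qed.

(** In contrast to [MA], every mark in [MB] has to be explained by a block below the vertex, as
    [lab_down] records; hence the last hypothesis. *)
Lemma labels_setB i j MA MB CA CB ok u :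
    labels i j MA MB CA CB ok -> idx u < i ->
    (forall chi, valid_coloring G r p rho chi -> chi u = true) ->
    (exists x, [/\ x != r, i <= idx x, rho x = x, p x = u & CB x = None]) ->
  labels i j MA (set_at MB u true) CA CB ok.
Proof.
case=> hA hB hCA hCB hCA0 hCB0 hpref hup hdown hdeg hok lt_u u_B ex_x; split=> //.
- move=> chi valid v; rewrite /set_at; case: eqP => [-> _ | _]; first exact: u_B.
  exact: hB.
- by move=> x w /hCA[w_r le_w rho_w NB]; rewrite (set_at_ltn _ _ lt_u).
- by move=> v C0 v_r le_v; apply/set_at_true/hCA0.
- move=> v w Cw v_r le_v; rewrite (set_at_ltn _ _ lt_u) // => Bv NAv.
  exact/set_at_true/(hpref _ _ Cw v_r).
- move=> v v_r le_v rho_v; have [up1 up2] := hup v v_r le_v rho_v.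
  by split=> // /up2/set_at_true.
- by move=> v; rewrite /set_at; case: eqP => [-> _ //| _]; apply: hdown.
case: (ok) hok => // hok v le_v; rewrite (set_at_ltn _ _ lt_u) //; exact: hok.
Qed.

Lemma idx_leP u v : (idx v <= idx u) = (u == v) || (idx v < idx u).
Proof. by rewrite leq_eqVlt (inj_eq (bt_inj bt)) eq_sym. Qed.

(** The root is a child in no block, so only the conflict between its two labels has to be
    tested. *)
Lemma labels_root j MA MB CA CB ok :
    labels (idx r).+1 j MA MB CA CB ok -> (degree G r = 1 -> MA r) ->
  labels (idx r) j MA MB CA CB (ok && ~~ (MA r && MB r)).
Proof.
case=> hA hB hCA hCB hCA0 hCB0 hpref hup hdown hdeg hok deg_r.
have le_i v : v != r -> idx r <= idx v -> idx r < idx v.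
  by rewrite idx_leP => /negPf->.
split=> //.
- by move=> x w /hCA[? /ltnW ? ? ?]; split.
- by move=> x w /hCB[? /ltnW ? ? ?]; split.
- by move=> v C0 v_r /le_i lt_v; apply: hCA0 => //; apply: lt_v.
- by move=> v C0 v_r /le_i lt_v; apply: hCB0 => //; apply: lt_v.
- by move=> v w Cw v_r /le_i lt_v; apply: hpref Cw _ _ => //; apply: lt_v.
- by move=> v /hdown[x [? /ltnW ? ? ? ?]]; exists x.
- by move=> v; rewrite idx_leP => /orP[/eqP-> // | /hdeg].
case: (ok) hok => //= hok; case: ifP => [NAB v | /negbFE/andP[Ar Br] chi valid].
  by rewrite idx_leP => /orP[/eqP-> // | /hok].
by have := hA _ valid _ Ar; rewrite (hB _ valid _ Br).
Qed.

(** The vertex is offered to its block for each colour not denied to it. For [true], a forced vertex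
    replaces an earlier candidate, while an unforced one only fills an empty slot; this maintains
    [lab_pref]. *)
Lemma labels_vertex v MA MB CA CB ok :
    labels (idx v).+1 (idx v).+1 MA MB CA CB ok -> v != r ->
    (degree G v = 1 -> MA v) ->
  labels (idx v) (idx v).+1 MA MB
    (if ~~ MB v then set_at CA (rho v) (Some v) else CA)
    (if ~~ MA v && (MB v || (CB (rho v) == None))
     then set_at CB (rho v) (Some v) else CB)
    (ok && ~~ (MA v && MB v)).
Proof.
case=> hA hB hCA hCB hCA0 hCB0 hpref hup hdown hdeg hok v_r deg_v.
have [rho_r p_rho rho_rho le_rho] := bt_rep bt v_r.
have rho_lt x : idx v < idx x -> x == rho v = false.
  by move=> lt_v; apply: contraTF lt_v => /eqP->; rewrite -leqNgt.
split=> //.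
- move=> x w; case: ifP => [NBv | Bv].
    rewrite /set_at; case: eqP => [-> [<-] // | _ /hCA[? /ltnW ? ? ?] //].
  by move/hCA=> [? /ltnW].
- move=> x w; case: ifP => [/andP[NAv _] | _].
    rewrite /set_at; case: eqP => [-> [<-] // | _ /hCB[? /ltnW ? ? ?] //].
  by move/hCB=> [? /ltnW].
- move=> u C0 u_r; rewrite idx_leP => le_u; case/orP: le_u C0 => [/eqP-> | lt_u].
    by case: ifPn => [_ | /negbNE //]; rewrite /set_at eqxx.
  case: ifP => [_|_ C0]; last exact: hCA0 C0 _ _.
  by rewrite /set_at; case: eqP => // _ C0; apply: hCA0 C0 _ _.
- move=> u C0 u_r; rewrite idx_leP => le_u; case/orP: le_u C0 => [/eqP-> | lt_u].
    case: ifPn => [_ | ]; first by rewrite /set_at eqxx.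
    by rewrite negb_and negbK => /orP[// |]; rewrite negb_or => /andP[_ /eqP].
  case: ifP => [_|_ C0]; last exact: hCB0 C0 _ _.
  by rewrite /set_at; case: eqP => // _ C0; apply: hCB0 C0 _ _.
- move=> u w Cw u_r; rewrite idx_leP => le_u Bu NAu.
  case/orP: le_u Cw Bu NAu => [/eqP-> | lt_u] + Bu NAu.
    by rewrite NAu Bu /= /set_at eqxx => -[<-].
  case: ifP => [/andP[NAv Bv]|_ Cw]; last exact: hpref Cw u_r lt_u Bu NAu.
  rewrite /set_at; case: eqP => [rho_u [<-] | _ Cw]; last exact: hpref Cw u_r lt_u Bu NAu.
  (* An empty slot would mean that [u] is forced to be [false]. *)
  case/orP: Bv => // /eqP C0; rewrite -rho_u in C0.
  by have := hCB0 u C0 u_r lt_u; rewrite (negPf NAu).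
- move=> u u_r lt_u rho_u; have [up1 up2] := hup u u_r lt_u rho_u.
  by split; case: ifP => // _; rewrite /set_at rho_lt.
- move=> u /hdown[x [x_r lt_x rho_x p_x C0]]; exists x; split=> //; first exact: ltnW.
  by case: ifP => // _; rewrite /set_at rho_lt.
- by move=> u; rewrite idx_leP => /orP[/eqP-> // | /hdeg].
case: (ok) hok => //= hok; case: ifP => [NAB u | /negbFE/andP[Av Bv] chi valid].
  by rewrite idx_leP => /orP[/eqP-> // | /hok].
by have := hA _ valid _ Av; rewrite (hB _ valid _ Bv).
Qed.

Lemma labels_skip v MA MB CA CB ok :
    labels (idx v) (idx v).+1 MA MB CA CB ok -> v == r \/ rho v != v ->
  labels (idx v) (idx v) MA MB CA CB ok.
Proof.
case=> hA hB hCA hCB hCA0 hCB0 hpref hup hdown hdeg hok skip; split=> // u u_r.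
rewrite idx_leP => /orP[/eqP u_v | lt_u] rho_u; last exact: hup.
move: skip; rewrite -u_v; by rewrite (negPf u_r) rho_u eqxx => -[].
Qed.

(** The representative has the least index in its class, so in reverse order the whole class has
    been seen. If no child may be [false], all are [true] in every valid colouring and the parent
    must be [false]; the other case is symmetric. *)
Lemma labels_block v MA MB CA CB ok :
    labels (idx v) (idx v).+1 MA MB CA CB ok -> v != r -> rho v = v ->
  labels (idx v) (idx v)
    (if CA v == None then set_at MA (p v) true else MA)
    (if CB v == None then set_at MB (p v) true else MB) CA CB ok.
Proof.
move=> lab v_r rho_v; have [_ lt_p] := bt_parent bt v_r.
have block_le w : w != r -> rho w = rho v -> idx v <= idx w.
  by move=> w_r rho_w; have [_ _ _] := bt_rep bt w_r; rewrite rho_w rho_v.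
have lab1 : labels (idx v) (idx v).+1
    (if CA v == None then set_at MA (p v) true else MA) MB CA CB ok.
  case: eqP => // C0; apply: labels_setA => // chi valid.
  have [w [w_r rho_w neq_w]] := valid.1 v v_r.
  have Bw : MB w by apply: (lab_CA0 lab); rewrite ?rho_w ?rho_v ?block_le.
  by move: neq_w; rewrite (lab_B lab valid Bw); case: (chi _).
have lab2 : labels (idx v) (idx v).+1
    (if CA v == None then set_at MA (p v) true else MA)
    (if CB v == None then set_at MB (p v) true else MB) CA CB ok.
  case: (CB v =P None) => // C0; apply: labels_setB => // [chi valid|]; last by exists v.
  have [w [w_r rho_w neq_w]] := valid.1 v v_r.
  have Aw : MA w by apply: (lab_CB0 lab); rewrite ?rho_w ?rho_v ?block_le.
  by move: neq_w; rewrite (lab_A lab valid Aw); case: (chi _).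
case: lab2 => hA hB hCA hCB hCA0 hCB0 hpref hup hdown hdeg hok; split=> // u u_r.
rewrite idx_leP => /orP[/eqP-> _ | lt_u rho_u]; last exact: hup.
by split=> ->; rewrite eqxx /set_at eqxx.
Qed.

End Labels.

(** * From labels to a spanning even tree *)

Lemma degree_neq1 (V : finType) (G : sgraph V) x y :
  G x y -> degree G x <> 1 -> exists2 z, G x z & z != y.
Proof.
move=> Gxy deg_x; have yx : y \in [set z | G x z] by rewrite inE.
have [z] : exists z, z \in [set z | G x z] :\ y.
  apply/card_gt0P; move: deg_x; rewrite /degree (cardsD1 y) yx.
  by case: #|_|.
by rewrite !inE => /andP[neq_zy Gxz]; exists z.
Qed.

Lemma leaf_uniq (V : finType) (T : sgraph V) x y z :
  leaf T x -> T x y -> T x z -> y = z.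
Proof.
move=> /cards1P[u def_u] Txy Txz.
have: y \in [set w | T x w] by rewrite inE.
have: z \in [set w | T x w] by rewrite inE.
by rewrite def_u !inE => /eqP-> /eqP.
Qed.

Section Colouring.
Variables (V : finType) (G : sgraph V) (r : V) (idx : V -> nat) (p rho : V -> V).
Hypothesis bt : block_tree G r idx p rho.
Variables (MA MB : V -> bool) (CA CB : V -> option V) (col : V -> bool) (q : V -> V).
Hypothesis lab : labels G r idx p rho 0 0 MA MB CA CB true.
Hypothesis col_root : col r = MB r.
Hypothesis colE : forall v, v != r ->
  col v = MB v || (~~ col (p v) && (CB (rho v) == Some v)).
Hypothesis qE : forall v, v != r ->
  q v = if col v == col (p v)
        then odflt r (if col (p v) then CA (rho v) else CB (rho v)) else p v.

Lemma col_MB v : MB v -> col v = true.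
Proof.
by have [-> | /colE->] := eqVneq v r => [|->//]; rewrite col_root.
Qed.

Lemma col_MA v : MA v -> col v = false.
Proof.
move=> Av; have := lab_ok lab v (leq0n _); rewrite Av /= => /negPf NBv.
have [v_r | /colE->] := eqVneq v r; first by rewrite v_r col_root -v_r.
rewrite NBv /=; apply/negP => /andP[_ /eqP/(lab_CB lab)[_ _ _]].
by rewrite Av.
Qed.

(** An empty slot would have forced the other colour on the parent. Below a [true] parent only
    forced vertices are [true], so the candidate in [CA] is [false]; below a [false] parent the
    candidate in [CB] is made [true]. Hence the default in [qE] is never reached. *)
Lemma anchorP x : x != r -> exists a,
  [/\ (if col (p x) then CA (rho x) else CB (rho x)) = Some a, a != r,
      rho a = rho x, p a = p x & col a = ~~ col (p x)].
Proof.
move=> x_r; have [rho_r p_rho rho_rho _] := bt_rep bt x_r.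
have [up1 up2] := lab_up lab rho_r (leq0n _) rho_rho.
have par a : a != r -> rho a = rho x -> p a = p x.
  by case/(bt_rep bt) => _ <- _ _ ->.
case col_p: (col (p x)).
  case Cx: (CA (rho x)) => [a|]; last first.
    by move: (up1 Cx); rewrite p_rho => /col_MA; rewrite col_p.
  have [a_r _ rho_a NBa] := lab_CA lab Cx.
  by exists a; rewrite (par a) // colE // (negPf NBa) (par a) // col_p.
case Cx: (CB (rho x)) => [a|]; last first.
  by move: (up2 Cx); rewrite p_rho => /col_MB; rewrite col_p.
have [a_r _ rho_a NAa] := lab_CB lab Cx.
by exists a; rewrite (par a) // colE // (par a) // col_p rho_a Cx eqxx orbT.
Qed.

Lemma qP v : v != r ->
  q v = p v /\ col v = ~~ col (p v) \/
  [/\ col v = col (p v), q v != r, rho (q v) = rho v, p (q v) = p v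
    & col (q v) = ~~ col (p v)].
Proof.
move=> v_r; rewrite qE //; case: eqP => [eq_col | /eqP neq_col]; last first.
  by left; split=> //; case: (col v) (col (p v)) neq_col => [] [].
by right; have [a [-> a_r rho_a p_a col_a]] := anchorP v_r.
Qed.

Lemma col_q v : v != r -> col v = ~~ col (q v).
Proof.
by case/qP => [[-> ->] // | [-> _ _ _ ->]]; rewrite negbK.
Qed.

Lemma adj_q v : v != r -> G v (q v).
Proof.
move=> v_r; case: (qP v_r) => [[-> _] | [_ q_r rho_q _ _]].
  by case: (bt_parent bt v_r).
apply: (bt_clique bt) => //; apply/eqP => v_q.
by have := col_q v_r; rewrite -v_q; case: (col v).
Qed.

(** The anchor differs in colour from the parent, so it is attached to it directly: every block
    contributes a tree edge at its parent vertex. *)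
Lemma q_anchor x : x != r -> exists a, [/\ a != r, rho a = rho x & q a = p x].
Proof.
move=> x_r; have [a [_ a_r rho_a p_a col_a]] := anchorP x_r.
exists a; split=> //; rewrite qE // p_a col_a.
by case: (col (p x)).
Qed.

(** Doubling the index of the parent leaves room for two levels: the children attached to it
    directly, and those attached to one of these. *)
Definition tree_rank v := if v == r then 0 else (idx (p v)).*2.+1 + (col v == col (p v)).

Lemma tree_rank_q v : v != r -> tree_rank (q v) < tree_rank v.
Proof.
move=> v_r; rewrite /tree_rank (negPf v_r).
case: (qP v_r) => [[-> _] | [eq_col q_r _ -> ->]]; last first.
  by rewrite (negPf q_r) eq_col eqxx; case: (col _) => /=; rewrite addn0 addn1.
case: (eqVneq (p v) r) => // p_r; have [_ lt_p] := bt_parent bt p_r.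
move: lt_p; case: (_ == _); case: (_ == _); clear; lia.
Qed.

Lemma coloured_tree : exists2 T : sgraph V, T =2 parent_rel r q & spanning_even_tree G T.
Proof.
have [T eqT treeT] := parent_tree tree_rank_q.
have T_q x : x != r -> T x (q x) by move=> x_r; rewrite eqT /parent_rel /= x_r eqxx.
have T_sym := @adj_sym _ T.
have T_q' x y : x != r -> q x = y -> T y x by rewrite T_sym => /T_q + <-.
exists T => //; split.
  move=> x y; rewrite eqT => /orP[] /andP[/adj_q + /eqP <-] //.
  by rewrite adj_sym.
apply: (coloring_even_tree (chi := col)) => // [x y | x leaf_x].
  rewrite eqT => /orP[] /andP[/col_q + /eqP <-] // => ->.
  by rewrite negbK.
(* A leaf of colour [true] is refuted by finding two tree neighbours of it. *)
apply/negP => col_x.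
(* Such an [x] is joined to [q x] and to the anchor of a block below it; these differ because ranks
   decrease along [q]. *)
have child y : y != r -> p y = x -> x != r -> False.
  move=> y_r p_y x_r; have [a [a_r _ q_a]] := q_anchor y_r.
  rewrite p_y in q_a; have q_x := leaf_uniq leaf_x (T_q x x_r) (T_q' a x a_r q_a).
  have := tree_rank_q x_r; have := tree_rank_q a_r; rewrite q_x q_a; clear; lia.
(* The root is [true] only if forced, so some block has all its children forced to be [false] and
   attached to the root. A second neighbour lies in this block, or in another block with an anchor
   of its own. *)
have [x_r | x_r] := eqVneq x r.
  have Bx : MB x by rewrite x_r -col_root -x_r.
  have [y [y_r _ rho_y p_y C0]] := lab_down lab Bx.
  have Gxy : G x y by rewrite adj_sym -p_y; case: (bt_parent bt y_r).
  have root_nbr z : G x z -> z != r /\ p z = x.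
    by case/(bt_adj bt) => [[] | [] | []]; rewrite x_r ?eqxx.
  have [|z Gxz neq_zy] := degree_neq1 Gxy.
    move=> deg_x; have := lab_ok lab x (leq0n _).
    by rewrite Bx (lab_deg lab _ deg_x).
  have [z_r p_z] := root_nbr z Gxz.
  have block_q w : w != r -> rho w = y -> p w = x -> T x w.
    move=> w_r rho_w p_w; apply: T_q' => //.
    have /col_MA col_w : MA w by apply: (lab_CB0 lab); rewrite ?rho_w.
    by rewrite qE // p_w col_w col_x.
  have T_xy := block_q y y_r rho_y p_y.
  have [rho_z | rho_z] := eqVneq (rho z) y.
    by move: neq_zy; rewrite (leaf_uniq leaf_x T_xy (block_q z z_r rho_z p_z)) eqxx.
  have [a [a_r rho_a q_a]] := q_anchor z_r; rewrite p_z in q_a.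
  have y_a := leaf_uniq leaf_x T_xy (T_q' a x a_r q_a).
  by move: rho_z; rewrite -rho_a -y_a rho_y eqxx.
have [G_p _] := bt_parent bt x_r.
have MB_child : MB x -> False.
  by case/(lab_down lab) => y [y_r _ _ p_y _]; apply: child y_r p_y x_r.
(* Without children, [x] can only be the candidate of its block below a [false] parent. It is not
   forced to be [false], so its degree is not 1, and another neighbour [y] is a sibling in the
   block. *)
move: col_x; rewrite colE // => /orP[/MB_child// | /andP[Np /eqP Cx]].
have [_ _ _ NAx] := lab_CB lab Cx.
have [|y Gxy neq_y] := degree_neq1 G_p.
  by move=> deg_x; move: NAx; rewrite (lab_deg lab _ deg_x).
case: (bt_adj bt Gxy) => [[y_r p_y] | [_ p_x] | [_ y_r p_y rho_y]].
- exact: child y_r p_y x_r.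
- by rewrite p_x eqxx in neq_y.
(* If [y] were forced to be [true], then by preference so would be the candidate [x], which has no
   child. Thus [y] is [false] and attached to [x], while [x] is attached to [p x]. *)
have NBy : ~~ MB y.
  apply/negP => By; apply: MB_child.
  have := lab_ok lab y (leq0n _); rewrite By andbT => NAy.
  by apply: (lab_pref lab (v := y) _ y_r (leq0n _) By NAy); rewrite -rho_y.
have neq_xy : x != y by apply: contraTneq Gxy => ->; rewrite adj_irr.
have col_y : col y = false.
  rewrite colE // (negPf NBy) -rho_y Cx -p_y Np /=.
  by apply/eqP => -[/eqP]; rewrite (negPf neq_xy).
have q_y : q y = x by rewrite qE // -p_y col_y (negPf Np) eqxx -rho_y Cx.
have q_x : q x = p x.
  by rewrite qE // colE // Np Cx eqxx orbT (negPf Np).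
have := leaf_uniq leaf_x (T_q' y x y_r q_y) (T_q x x_r).
by rewrite q_x => y_p; rewrite y_p eqxx in neq_y.
Qed.

End Colouring.

(** * Breadth-first search *)

Lemma update_ord n (f : nat -> nat) (v w : 'I_n) a :
  update f v a w = if w == v then a else f w.
Proof. by rewrite /update -val_eqE. Qed.

Lemma index_rcons (T : eqType) (s : seq T) x y :
  index x (rcons s y) =
    if x \in s then index x s else if x == y then size s else (size s).+1.
Proof.
rewrite -cats1 index_cat; case: ifP => //= _.
by rewrite eq_sym; case: eqP; rewrite ?addn0 ?addn1.
Qed.

Lemma mem_uniq_ord n (o : seq 'I_n) : uniq o -> size o = n -> forall v, v \in o.
Proof.
move=> uniq_o sz_o v.
have card_o : #|o| = #|'I_n| by rewrite (card_uniqP uniq_o) card_ord.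
by rewrite (elimT (subset_cardP card_o) (subset_predT _)).
Qed.

Section Search.
Variables (n : nat) (G : sgraph 'I_n) (L : 'I_n -> seq 'I_n) (r : 'I_n).
Hypotheses (bG : block_graph G) (LP : adjacency_lists G L).
Implicit Types (o : seq 'I_n) (p : 'I_n -> 'I_n) (ord par rep : nat -> nat).

Definition same_block p v w := [/\ v != r, w != r, p v = p w & v = w \/ G v w].

(* The arcs leaving the vertices of [o] before position [h] and the first [k]
   arcs leaving the vertex at position [h]. *)
Definition scanned o h k u v :=
  [/\ u \in o, G u v & index u o < h \/ index u o = h /\ index v (L u) < k].

(* [o] is the queue, [p] gives the vertex from which a vertex was discovered. *)
Record search o p h k ord par rep : Prop := Search {
  s_uniq : uniq o;
  s_root : r \in o /\ index r o = 0;
  s_proot : p r = r;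
  s_head : h <= size o;
  s_arc : h < size o -> k <= size (L (nth r o h));
  s_ord : forall i, i < size o -> ord i = nth r o i;
  s_par : forall v : 'I_n,
    par v = if v \in o then if v == r then n.+1 else (p v).+1 else 0;
  s_tree : forall v, v \in o -> v != r ->
    [/\ G v (p v), p v \in o, index (p v) o < index v o & index (p v) o <= h];
  s_scan : forall u v, scanned o h k u v ->
    v \in o /\ (v != r -> index (p v) o <= index u o);
  s_rep : forall v : 'I_n, v != r -> rep v != 0 -> exists x : 'I_n,
    [/\ rep v = x.+1, v \in o, x \in o, same_block p v x
      & forall y, y \in o -> same_block p v y -> index x o <= index y o];
  s_sibling : forall u v, scanned o h k u v -> u != r -> v != r -> p u = p v ->
    rep v != 0;
  s_done : forall u, u \in o -> index u o < h -> rep u != 0 }.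

(** The zero array already represents the queue that consists of vertex 0; only the mark [n.+1] of
    the root is written. *)
Lemma search_init : val r = 0 ->
  search [:: r] (fun=> r) 0 0 (fun=> 0) (update (fun=> 0) r n.+1) (fun=> 0).
Proof.
move=> r0; split=> //=.
- by rewrite inE eqxx.
- by case.
- by move=> v; rewrite update_ord inE; case: eqP.
- by move=> v; rewrite inE => ->.
- by move=> u v [_ _ []] // [].
- by move=> u v [_ _ []] // [].
Qed.

Lemma same_block_sym p v w : same_block p v w -> same_block p w v.
Proof.
case=> ? ? ? vw; split=> //; case: vw => [-> | Gvw]; first by left.
by right; rewrite adj_sym.
Qed.

(** The common parent, [u], [v] and [w] form a cycle, which induces a clique. *)
Lemma same_block_trans o p h k ord par rep u v w :
    search o p h k ord par rep -> u \in o -> v \in o -> w \in o ->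
  same_block p u v -> same_block p v w -> same_block p u w.
Proof.
move=> S uo vo wo [u_r v_r p_uv uv] [_ w_r p_vw vw].
split=> //; first by rewrite p_uv.
case: uv => [-> // | Guv]; case: vw => [<- | Gvw]; first by right.
have [-> | neq_uw] := eqVneq u w; [by left | right].
have [Gu _ lt_u _] := s_tree S uo u_r.
have [Gv _ lt_v _] := s_tree S vo v_r.
have [Gw _ lt_w _] := s_tree S wo w_r.
have neq a b : G a b -> a != b by apply: contraTneq => ->; rewrite adj_irr.
apply: (block_graph_cycle (c := [:: p u; u; v; w])) => //.
- rewrite /ucycle /= adj_sym Gu Guv Gvw p_uv p_vw Gw /= !inE !negb_or neq_uw.
  by rewrite -p_vw -{1}p_uv ![p _ == _]eq_sym neq // neq // p_vw neq // neq // neq.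
- by rewrite !inE eqxx orbT.
- by rewrite !inE eqxx !orbT.
Qed.

(** A member of the block of [u] earlier in the queue would have been scanned completely, and its
    arc to [u] would have given [u] a representative. So [u] is the first of its block and may
    represent it. *)
Lemma search_head o p h k ord par rep (u : 'I_n) :
    search o p h k ord par rep -> h < size o -> u = nth r o h -> rep u = 0 ->
  search o p h k ord par (update rep u u.+1).
Proof.
move=> S lt_h def_u rep_u.
have uo : u \in o by rewrite def_u mem_nth.
have idx_u : index u o = h by rewrite def_u index_uniq ?(s_uniq S).
case: (S) => uniq_o root proot le_h le_k ordP parP treeP scanP repP sibP doneP.
split=> //.
- move=> v v_r; rewrite update_ord; case: (v =P u) => [v_u _ | _]; last exact: repP.
  exists u; rewrite v_u; split=> //; rewrite -?v_u; first by split=> //; left.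
  move=> y yo vy; rewrite leqNgt v_u idx_u; apply/negP => lt_y.
  have [y_r _ p_y [y_v | Gyv]] := same_block_sym vy.
    by rewrite y_v v_u idx_u ltnn in lt_y.
  have := sibP y v; rewrite v_u rep_u -v_u => H.
  by suff: 0 != 0 by []; apply: H => //; split=> //; left.
- move=> x v sc x_r v_r p_xv; rewrite update_ord; case: (v =P u) => // _.
  exact: sibP sc x_r v_r p_xv.
by move=> v vo lt_v; rewrite update_ord; case: (v =P u) => // _; apply: doneP.
Qed.

Lemma search_next o p h k ord par rep :
    search o p h k ord par rep -> h < size o -> k = size (L (nth r o h)) ->
    rep (nth r o h) != 0 ->
  search o p h.+1 0 ord par rep.
Proof.
move=> S lt_h def_k rep_u.
case: (S) => uniq_o root proot le_h le_k ordP parP treeP scanP repP sibP doneP.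
have scE u v : scanned o h.+1 0 u v -> scanned o h k u v.
  case=> uo Guv [|[_ //]]; rewrite ltnS leq_eqVlt => /orP[/eqP idx_u | lt_u].
    split=> //; right; split=> //.
    by rewrite def_k -idx_u nth_index // index_mem; have [_ ->] := LP u.
  by split=> //; left.
split=> //.
- by move=> v vo /(treeP v vo)[? ? ? /leqW].
- by move=> u v /scE /scanP.
- by move=> u v /scE /sibP.
move=> u uo; rewrite ltnS leq_eqVlt => /orP[/eqP idx_u | ]; last exact: doneP.
by rewrite -(nth_index r uo) idx_u.
Qed.

Lemma scannedS o h k u v w : uniq o -> h < size o -> k < size (L (nth r o h)) ->
    w = nth r (L (nth r o h)) k ->
  scanned o h k.+1 u v -> scanned o h k u v \/ u = nth r o h /\ v = w.
Proof.
move=> uniq_o lt_h lt_k def_w [uo Guv [lt_u | [idx_u]]].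
  by left; split=> //; left.
rewrite ltnS leq_eqVlt => /orP[/eqP idx_v | lt_v]; last by left; split=> //; right.
have def_u : u = nth r o h by rewrite -idx_u nth_index.
right; split=> //; rewrite def_w -def_u -idx_v nth_index //.
by have [_ ->] := LP u.
Qed.

(** If [u] and [w] have the same parent, being adjacent they lie in one block with it, and [w]
    inherits the representative of [u]. *)
Lemma search_old o p h k ord par rep (u w : 'I_n) :
    search o p h k ord par rep -> h < size o -> u = nth r o h ->
    k < size (L u) -> w = nth r (L u) k -> par w != 0 -> rep u != 0 ->
  search o p h k.+1 ord par
    (if (par w == par u) && (rep w == 0) then update rep w (rep u) else rep).
Proof.
move=> S lt_h def_u lt_k def_w par_w rep_u.
have uo : u \in o by rewrite def_u mem_nth.
have idx_u : index u o = h by rewrite def_u index_uniq ?(s_uniq S).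
have Guw : G u w by have [_ /(_ w)] := LP u; rewrite def_w mem_nth.
have neq_uw : u != w by apply: contraTneq Guw => ->; rewrite adj_irr.
case: (S) => uniq_o root proot le_h le_k ordP parP treeP scanP repP sibP doneP.
have wo : w \in o by apply: contraNT par_w; rewrite parP => /negPf->.
(* The mark [n.+1] of the root exceeds all marks [(p v).+1], so equal marks identify siblings. *)
have par_eq : (par w == par u) = [&& u != r, w != r & p u == p w].
  rewrite !parP uo wo; case: (eqVneq u r) neq_uw => [-> | u_r] neq_uw.
    by rewrite [w == r]eq_sym (negPf neq_uw) eqSS ltn_eqF.
  case: (eqVneq w r) => [_ | w_r] /=; first by rewrite eqSS gtn_eqF.
  by rewrite eqSS -val_eqE eq_sym.
have scE a b : scanned o h k.+1 a b -> scanned o h k a b \/ a = u /\ b = w.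
  by rewrite def_u; apply: scannedS; rewrite -?def_u.
split=> //.
- by rewrite -def_u.
- move=> a b /scE[/scanP// | [-> ->]]; split=> // w_r.
  by case: (treeP w wo w_r); rewrite idx_u.
- move=> v v_r; case: ifP => [/andP[] | _]; last exact: repP.
  rewrite par_eq => /and3P[u_r w_r /eqP p_uw] rep_w; rewrite update_ord.
  case: (v =P w) => [-> _ | _]; last exact: repP.
  have [x [rep_x _ xo ux min_x]] := repP u u_r rep_u.
  have uw : same_block p u w by split=> //; right.
  exists x; split=> //.
    by apply: (same_block_trans S _ _ _ (same_block_sym uw) ux).
  by move=> y yo wy; apply: min_x => //; apply: (same_block_trans S _ _ _ uw wy).
- move=> a b /scE[sc | [-> ->]] a_r b_r p_ab.
    have rep_b := sibP a b sc a_r b_r p_ab.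
    by case: ifP => // _; rewrite update_ord; case: (b =P w).
  rewrite par_eq a_r b_r p_ab eqxx /=; case: ifPn => // _.
  by rewrite update_ord eqxx.
move=> v vo /(doneP v vo) rep_v.
by case: ifP => // _; rewrite update_ord; case: (v =P w).
Qed.

Lemma search_new o p h k ord par rep (u w : 'I_n) :
    search o p h k ord par rep -> h < size o -> u = nth r o h ->
    k < size (L u) -> w = nth r (L u) k -> par w = 0 ->
  search (rcons o w) [eta p with w |-> u] h k.+1
    (update ord (size o) w) (update par w u.+1) rep.
Proof.
move=> S lt_h def_u lt_k def_w par_w.
have uo : u \in o by rewrite def_u mem_nth.
have idx_u : index u o = h by rewrite def_u index_uniq ?(s_uniq S).
have Guw : G u w by have [_ /(_ w)] := LP u; rewrite def_w mem_nth.
case: (S) => uniq_o root proot le_h le_k ordP parP treeP scanP repP sibP doneP.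
have wo : w \notin o by move: par_w; rewrite parP; case: ifP => // _; case: ifP.
have neq_w v : v \in o -> v == w = false by move=> vo; apply: contraNF wo => /eqP<-.
have idx_o v : v \in o -> index v (rcons o w) = index v o by rewrite index_rcons => ->.
have idx_w : index w (rcons o w) = size o by rewrite index_rcons (negPf wo) eqxx.
have w_r : w != r by rewrite eq_sym neq_w ?root.1.
have nth_h : nth r (rcons o w) h = u by rewrite nth_rcons lt_h.
have mem_o v : v \in rcons o w -> v = w \/ v \in o.
  by rewrite mem_rcons inE => /orP[/eqP|]; [left | right].
have o_mem v : v \in o -> v \in rcons o w by rewrite mem_rcons inE orbC => ->.
have scE a b : scanned (rcons o w) h k.+1 a b -> scanned o h k a b \/ a = u /\ b = w.
  move=> [/mem_o[-> | ao] Gab].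
    by rewrite idx_w => -[|[]]; move: lt_h; clear; lia.
  rewrite idx_o // => sc; rewrite def_u.
  by apply: scannedS; rewrite -?def_u.
split=> //.
- by rewrite rcons_uniq wo.
- by rewrite o_mem ?root.1 // idx_o ?root.1 // root.2.
- by rewrite /= eq_sym (negPf w_r).
- by rewrite size_rcons leqW.
- by rewrite nth_h.
- move=> i; rewrite size_rcons ltnS nth_rcons /update leq_eqVlt.
  by case: eqP => [-> _ | _ /= lt_i]; rewrite ?ltnn // lt_i ordP.
- move=> v; rewrite update_ord mem_rcons inE parP /=.
  by case: (eqVneq v w) => [-> | //]; rewrite (negPf w_r).
- move=> v /mem_o[-> | vo] v_r /=.
    by rewrite eqxx adj_sym idx_w o_mem // idx_o // idx_u.
  by have [? po ? ?] := treeP v vo v_r; rewrite neq_w // !idx_o // o_mem.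
- move=> a b /scE[/[dup] -[ao _ _] /scanP[bo le_b] | [-> ->]].
    rewrite o_mem //= neq_w // [index a _]idx_o //; split=> // b_r.
    by have [_ po _ _] := treeP b bo b_r; rewrite idx_o // le_b.
  rewrite mem_rcons mem_head /= eqxx; split=> // _.
- move=> v v_r /(repP v v_r)[x [rep_v vo xo [_ x_r p_vx vx] min_x]].
  exists x; rewrite !o_mem //; split=> //; first by split=> //=; rewrite !neq_w.
  move=> y /mem_o[-> _ | yo [_ y_r p_vy vy]].
    by rewrite idx_w idx_o // ltnW // index_mem.
  rewrite !idx_o // min_x //; split=> //.
  by move: p_vy; rewrite /= !neq_w.
move=> a b /scE[/[dup] -[ao _ _] /[dup] sc /scanP[bo _] | [-> ->]] a_r b_r.
  by rewrite /= !neq_w //; apply: sibP.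
(* The ends of the new arc are not siblings: [u] would be its own parent. *)
rewrite /= eqxx neq_w // => p_u.
by have [_ _] := treeP u uo a_r; rewrite p_u ltnn.
move=> v /mem_o[-> | vo]; first by rewrite idx_w; move: lt_h; clear; lia.
by rewrite idx_o //; apply: doneP.
Qed.

(** The main point is [bt_adj]: an edge that is not a parent edge lies on a fundamental cycle, hence
    in a clique, and both its ends turn out to be children of the nearest common ancestor. *)
Lemma search_block_tree o p h k ord par rep :
    search o p h k ord par rep -> h = size o -> size o = n ->
  exists rho, block_tree G r (index^~ o) p rho /\
    (forall v : 'I_n, v != r -> rep v = (rho v).+1).
Proof.
move=> S def_h sz_o.
case: (S) => uniq_o root proot le_h le_k ordP parP treeP scanP repP sibP doneP.
have mem_o := mem_uniq_ord uniq_o sz_o.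
have sc u v : G u v -> scanned o h k u v.
  by move=> Guv; split=> //; left; rewrite def_h index_mem.
have /fin_all_exists[rho rhoP] : forall v, exists x : 'I_n, v != r ->
    [/\ rep v = x.+1, same_block p v x
      & forall y, same_block p v y -> index x o <= index y o].
  move=> v; have [-> | v_r] := eqVneq v r; first by exists r.
  have [|x [rep_x _ xo vx min_x]] := repP v v_r.
    by apply: doneP => //; rewrite def_h index_mem.
  by exists x => _; split=> // y; apply: min_x.
exists rho; split=> [|v /rhoP[] //].
have idx_inj : injective (index^~ o) by move=> u v; apply: index_inj.
have trans u v w := same_block_trans S (mem_o u) (mem_o v) (mem_o w).
have rho_eq u v : same_block p u v -> rho u = rho v.
  move=> /[dup] uv [u_r v_r _ _].
  have [_ u_rho min_u] := rhoP u u_r; have [_ v_rho min_v] := rhoP v v_r.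
  apply: idx_inj; apply/eqP; rewrite eqn_leq min_u ?min_v //.
    exact: trans (same_block_sym uv) u_rho.
  exact: trans uv v_rho.
have p_tree v : v != r -> G v (p v) /\ index (p v) o < index v o.
  by case/(treeP v (mem_o v)).
have root_nbr v : G r v -> p v = r.
  move=> Grv; have v_r : v != r by apply: contraTneq Grv => ->; rewrite adj_irr.
  have [_ /(_ v_r)] := scanP _ _ (sc _ _ Grv); rewrite root.2 leqn0 => /eqP idx_p.
  by apply: idx_inj; rewrite idx_p root.2.
split=> //.
- move=> v w Gvw; have neq_vw : v != w by apply: contraTneq Gvw => ->; rewrite adj_irr.
  have [v_r | v_r] := eqVneq v r.
    by constructor 1; rewrite v_r root_nbr -?v_r // eq_sym.
  have [w_r | w_r] := eqVneq w r.
    by constructor 2; rewrite w_r root_nbr -?w_r // adj_sym.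
  have [p_v | p_v] := eqVneq (p v) w; first by constructor 2.
  have [p_w | p_w] := eqVneq (p w) v; first by constructor 1.
  have [c [z [cyc_c sz_c zc [vc wc pvc pwc min_z]]]] :
     exists c z, [/\ ucycle G c, 2 < size c, z \in c &
       [/\ v \in c, w \in c, (v != z -> p v \in c), (w != z -> p w \in c) &
         forall u, u \in c -> index z o <= index u o]].
    apply: (@fundamental_cycle _ _ r p) => //; rewrite ?p_v ?p_w ?orbT //.
    exact: adj_sym.
  have clq := block_graph_cycle bG cyc_c sz_c.
  (* The clique makes [x] a neighbour of [z], so its parent is not later than [z] in the queue;
     lying on the cycle, the parent is not earlier either. *)
  have par_z x : x \in c -> x != r -> x != z -> (x != z -> p x \in c) -> p x = z.
    move=> xc x_r neq_xz /(_ neq_xz) pxc; apply: idx_inj; apply/eqP.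
    rewrite eqn_leq min_z // andbT.
    have Gzx : G z x by apply: clq; rewrite // eq_sym.
    by have [_ /(_ x_r)] := scanP z x (sc z x Gzx).
  have [v_z | neq_vz] := eqVneq v z.
    by move: p_w; rewrite (par_z w) // -v_z ?eqxx // eq_sym.
  have [w_z | neq_wz] := eqVneq w z.
    by move: p_v; rewrite (par_z v) // -w_z ?eqxx.
  have p_vw : p v = p w.
    exact: etrans (par_z v vc v_r neq_vz pvc) (esym (par_z w wc w_r neq_wz pwc)).
  by constructor 3; split=> //; apply: rho_eq; split; [| | | right].
- move=> v v_r; have [_ v_rho min_v] := rhoP v v_r; have [_ rho_r p_rho _] := v_rho.
  by split=> //; [rewrite -(rho_eq _ _ v_rho) | apply: min_v; split=> //; left].
move=> v w v_r w_r rho_vw neq_vw.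
have [_ v_rho _] := rhoP v v_r; have [_ w_rho _] := rhoP w w_r.
rewrite rho_vw in v_rho.
have [_ _ _ [v_w | //]] := trans _ _ _ v_rho (same_block_sym w_rho).
by rewrite v_w eqxx in neq_vw.
Qed.

(** An exhausted queue is closed under adjacency, but a spanning tree would have an edge leaving
    it. *)
Lemma search_disconnected o p h k ord par rep :
    search o p h k ord par rep -> h = size o -> size o != n ->
  ~ exists T : sgraph 'I_n, spanning_even_tree G T.
Proof.
move=> S def_h sz_o [T [sub_TG [[_ /connected_in_setT conn _] _]]].
case/negP: sz_o; rewrite -(card_uniqP (s_uniq S)) -[X in _ == X]card_ord.
apply/eqP/eq_card => v; rewrite [RHS]inE; apply/negPn/negP => NDv.
have [u [w [uo NDw Tuw]]] := connect_exit (D := [in o]) (conn r v) (s_root S).1 NDv.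
case/negP: NDw; have [] // := s_scan S (u := u) (v := w).
by split=> //; [exact: sub_TG | left; rewrite def_h index_mem].
Qed.

End Search.

(** * The program *)

Section Layout.
Variables (n : nat) (G : sgraph 'I_n) (L : 'I_n -> seq 'I_n).
Hypothesis LP : adjacency_lists G L.

(** The list form of the sum in [offsets], suited to positions in a flattened list. *)
Definition offset (v : 'I_n) := sumn [seq size (L w) | w <- take v (enum 'I_n)].

Lemma take_enum_ord (v : 'I_n) :
  enum 'I_n = take v (enum 'I_n) ++ v :: drop v.+1 (enum 'I_n).
Proof.
by rewrite -{1}(cat_take_drop v (enum 'I_n)) (drop_nth v) ?size_enum_ord // nth_ord_enum.
Qed.

Lemma nth_offsets (v : 'I_n) : nth 0 (offsets L) v = offset v.
Proof.
rewrite nth_mkseq ?ltnS 1?ltnW // /offset sumnE big_map.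
transitivity (\sum_(w <- enum 'I_n | w < v) size (L w)).
  by rewrite big_enum_cond; apply: eq_bigl => w; rewrite inE.
rewrite (take_enum_ord v) big_cat big_cons ltnn /=.
have vals : map val (enum 'I_n) = iota 0 n by rewrite val_enum_ord.
rewrite [X in _ + X]big1_seq ?addn0 => [|w /andP[lt_w w_drop]].
  rewrite -(take_enum_ord v) big_seq_cond [RHS]big_seq.
  apply: eq_bigl => w; case w_take: (w \in _) => //=.
  have := map_f val w_take; rewrite map_take vals take_iota mem_iota.
  by move=> /andP[_]; rewrite add0n leq_min => /andP[].
have := map_f val w_drop; rewrite map_drop vals drop_iota mem_iota add0n.
by move=> /andP[/ltnW]; rewrite leqNgt lt_w.
Qed.

Lemma nth_offsetsS (v : 'I_n) : nth 0 (offsets L) v.+1 = offset v + size (L v).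
Proof.
rewrite -nth_offsets !nth_mkseq ?ltnS // 1?ltnW //.
rewrite (bigD1 v) //= addnC; congr (_ + _); apply: eq_bigl => w.
by rewrite ltnS [RHS]ltn_neqAle andbC.
Qed.

Lemma nth_neighbours (v r : 'I_n) k : k < size (L v) ->
  nth 0 (neighbours L) (offset v + k) = nth r (L v) k.
Proof.
move=> lt_k; rewrite /neighbours (take_enum_ord v) map_cat flatten_cat map_cat /=.
rewrite map_cat nth_cat size_map size_flatten /shape -map_comp -/(offset v).
rewrite ltnNge leq_addr /= addKn nth_cat size_map lt_k.
by rewrite (nth_map r).
Qed.

Definition arcs := sumn [seq size (L v) | v <- enum 'I_n].

Lemma size_list v : size (L v) = degree G v.
Proof.
have [uniq_v mem_v] := LP v; rewrite -(card_uniqP uniq_v) /degree.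
by apply: eq_card => w; rewrite mem_v inE.
Qed.

(** The arcs split into ascending and descending ones; either kind contains no arc together with its
    reverse, so it injects into the edges. *)
Lemma arcs_le_edges : arcs <= 2 * #|edges G|.
Proof.
have half (B : {set 'I_n * 'I_n}) :
    (forall x y, (x, y) \in B -> G x y /\ (y, x) \notin B) -> #|B| <= #|edges G|.
  move=> BP; rewrite -(card_in_imset (f := fun e => [set e.1; e.2])).
    apply: subset_leq_card; apply/subsetP => _ /imsetP[[x y] /BP[Gxy _] ->].
    by apply/imsetP; exists (x, y); rewrite ?inE.
  move=> [a b] [c d] /BP[Gab Nab] Bcd /= eq_e.
  have: a \in [set c; d] by rewrite -eq_e !inE eqxx.
  have: b \in [set c; d] by rewrite -eq_e !inE eqxx orbT.
  have neq_ab : a != b by apply: contraTneq Gab => ->; rewrite adj_irr.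
  rewrite !inE => /orP[] /eqP ? /orP[] /eqP ?; subst=> //.
  - by rewrite eqxx in neq_ab.
  - by rewrite Bcd in Nab.
  - by rewrite eqxx in neq_ab.
have -> : arcs = #|[set e : 'I_n * 'I_n | G e.1 e.2]|.
  rewrite /arcs sumnE big_map big_enum /= -sum1_card.
  rewrite (eq_bigl (fun e : 'I_n * 'I_n => G e.1 e.2)) => [|e]; last by rewrite inE.
  rewrite -(pair_big_dep predT (fun x y => G x y) (fun _ _ => 1)) /=.
  by apply: eq_bigr => v _; rewrite sum1_card size_list; apply: eq_card => w; rewrite inE.
rewrite mul2n -addnn.
rewrite -(cardsID [set e : 'I_n * 'I_n | e.1 < e.2] [set e | G e.1 e.2]).
apply: leq_add; apply: half => x y; rewrite !inE /=.
  by move=> /andP[-> lt_xy]; rewrite negb_and -leqNgt ltnW ?orbT.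
rewrite -leqNgt => /andP[le_yx Gxy]; split=> //.
have : y != x by apply: contraTneq Gxy => ->; rewrite adj_irr.
by rewrite -val_eqE /= negb_and negbK ltn_neqAle le_yx => ->.
Qed.

(** The queue has no repetition, so the lists scanned from it contain at most all arcs. *)
Lemma sum_take_le o h : uniq o -> sumn [seq size (L v) | v <- take h o] <= arcs.
Proof.
move=> uniq_o; rewrite /arcs !sumnE 2!big_map [leqRHS]big_enum /=.
rewrite [leqRHS](bigID [in take h o]) /=.
by rewrite -big_uniq ?take_uniq // leq_addr.
Qed.

End Layout.

(* Registers: 2 head of the queue, 3 its size, 4 position in array 1, 5 current
   vertex of the search, 6 its neighbour; 7 position in the queue, 8 current
   vertex, 9 and 11 its block or its parent, 10 failure, 12 the child to which
   the vertex is attached unless it is attached to its parent. Arrays: 4 queue, 5 parent + 1 (n + 1 for the root),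
   6 block + 1, 7-8 [MA] and [MB], 9-10 [CA] and [CB], 11 colour. In arrays 5, 6,
   9 and 10, 0 means undefined. *)
Notation "p1 ;; p2" := (Seq p1 p2) (at level 91, right associativity).

(* [mem] is the membership predicate of ssrbool here. *)
Notation arr := Defs.mem.

(** * The search phase *)

Definition search_mark : com :=
  Assign 5 (Read 4 (Reg 2)) ;;
  If (Read 6 (Reg 5)) Skip (Write 6 (Reg 5) (Succ (Reg 5))).

(** One iteration scans one arc or advances the head. A single flat loop replaces the usual nested
    ones, so its body is loop-free and its iterations are bounded by vertices plus arcs. *)
Definition search_scan : com :=
  If (Lt (Reg 4) (Read 0 (Succ (Reg 5))))
    (Assign 6 (Read 1 (Reg 4)) ;;
     Assign 4 (Succ (Reg 4)) ;;
     If (Read 5 (Reg 6))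
       (If (Eq (Read 5 (Reg 6)) (Read 5 (Reg 5)))
          (If (Read 6 (Reg 6)) Skip (Write 6 (Reg 6) (Read 6 (Reg 5))))
          Skip)
       (Write 4 (Reg 3) (Reg 6) ;;
        Write 5 (Reg 6) (Succ (Reg 5)) ;;
        Assign 3 (Succ (Reg 3))))
    (Assign 2 (Succ (Reg 2)) ;;
     Assign 4 (Read 0 (Read 4 (Reg 2)))).

Definition search_test : expr := Lt (Reg 2) (Reg 3).

Section SearchPhase.
Variables (n : nat) (G : sgraph 'I_n) (L : 'I_n -> seq 'I_n) (r : 'I_n).
Hypotheses (bG : block_graph G) (LP : adjacency_lists G L).

(** The potential [m] is [n + arcs L] minus the progress made: the head position, the lists
    completed and the arcs scanned in the current list. The clean arrays are kept for the later
    phases. *)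
Record search_state m o p k (s : state) : Prop := SearchState {
  ss_search : search G L r o p (regs s 2) k (arr s 4) (arr s 5) (arr s 6);
  ss_n : regs s 0 = n;
  ss_tail : regs s 3 = size o;
  ss_arc : regs s 2 < size o -> regs s 4 = offset L (nth r o (regs s 2)) + k;
  ss_offsets : arr s 0 = nth 0 (offsets L);
  ss_neighbours : arr s 1 = nth 0 (neighbours L);
  ss_clean : regs s 10 = 0 /\ forall a i, 6 < a -> arr s a i = 0;
  ss_measure : m + (regs s 2 + sumn [seq size (L v) | v <- take (regs s 2) o] + k)
    = n + arcs L }.

Lemma search_mark_state m o p k s :
    search_state m o p k s -> regs s 2 < size o ->
  let s' := run search_mark s in
  [/\ search_state m o p k s', regs s' 2 = regs s 2,
      regs s' 5 = nth r o (regs s 2) & arr s' 6 (nth r o (regs s 2)) != 0].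
Proof.
case=> S sn st sa so sb [sf sc] sm lt_h.
have ord_h := s_ord S lt_h.
rewrite /search_mark /=; rewrite /update /= ord_h.
case: ifP => [/eqP rep_u | /negbT rep_u] /=; last by split.
rewrite /update /=; split=> //; last by rewrite eqxx.
split=> //=; last by split=> // a i lt_a; rewrite /update gtn_eqF ?sc.
exact: (search_head S lt_h erefl rep_u).
Qed.

Lemma search_scan_state m o p k s :
    search_state m o p k s -> regs s 2 < size o ->
    regs s 5 = nth r o (regs s 2) -> arr s 6 (nth r o (regs s 2)) != 0 ->
  exists o' p' k', search_state m.-1 o' p' k' (run search_scan s) /\ 0 < m.
Proof.
case=> S sn st sa so sb [sf sc] sm lt_h.
set u := nth r o (regs s 2) => reg_u rep_u.
have arc_eq := sa lt_h.
have uniq_o := s_uniq S.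
have le_o : size o <= n by rewrite -(card_uniqP uniq_o) -[leqRHS]card_ord max_card.
have take_S : sumn [seq size (L v) | v <- take (regs s 2).+1 o] =
    sumn [seq size (L v) | v <- take (regs s 2) o] + size (L u).
  by rewrite (take_nth r lt_h) map_rcons sumn_rcons.
have le_arcs := sum_take_le L (regs s 2).+1 uniq_o.
rewrite take_S in le_arcs.
have le_k := s_arc S lt_h; rewrite -/u in le_k.
(* The head is still below [n] and the scanned arcs are among all arcs, so the potential is not
   exhausted. *)
have m_gt0 : 0 < m by move: sm le_arcs le_k lt_h le_o; clear; lia.
rewrite /search_scan /=; rewrite /update /= reg_u so nth_offsetsS arc_eq -/u ltn_add2l.
case: (ltnP k (size (L u))) => /= [lt_k | ge_k]; last first.
  have def_k : k = size (L u) by apply/eqP; rewrite eqn_leq le_k ge_k.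
  exists o, p, 0; split=> //; split=> //=.
  - exact: (search_next LP S lt_h def_k rep_u).
  - by move=> lt_h'; rewrite /update /= (s_ord S) // nth_offsets addn0.
  - by move: sm m_gt0; rewrite take_S -def_k /update /=; clear; lia.
rewrite sb (nth_neighbours r lt_k); set w := nth r (L u) k.
rewrite /update /= ?reg_u.
have sm' : m.-1 + (regs s 2 + sumn [seq size (L v) | v <- take (regs s 2) o] + k.+1)
    = n + arcs L by move: sm m_gt0; clear; lia.
case: ifP => [/eqP par_w | /negbT par_w] /=.
  exists (rcons o w), [eta p with w |-> u], k.+1.
  split=> //; split=> //=; rewrite /update /= ?st.
  - exact: (search_new LP S lt_h erefl lt_k erefl par_w).
  - by rewrite size_rcons.
  - by move=> _; rewrite nth_rcons lt_h addnS.
  - by split=> // a i lt_a; rewrite !gtn_eqF ?sc // (leq_trans _ lt_a).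
  - by rewrite -cats1 takel_cat // ltnW.
have := search_old bG LP S lt_h erefl lt_k erefl par_w rep_u.
rewrite -/u -/w eqb0; case: eqP => _ /=; last first.
  by move=> S'; exists o, p, k.+1; split=> //; split=> //= _; rewrite /update /= addnS.
case: eqP => _ S' /=; exists o, p, k.+1; split=> //; split=> //=.
- by move=> _; rewrite /update /= addnS.
- by split=> // a i lt_a; rewrite /update gtn_eqF ?sc.
- by move=> _; rewrite /update /= addnS.
Qed.

Definition search_body : com := search_mark ;; search_scan.

Lemma search_phase m o p k s :
    search_state m o p k s ->
  exists t s' m' o' p' k',
    [/\ exec (While search_test search_body) s t s',
        t <= while_cost search_test search_body * m.+1,
        search_state m' o' p' k' s' & regs s' 2 = size o'].
Proof.
move=> Ss; pose I m s := exists o p k, search_state m o p k s.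
have Is : I m s by exists o, p, k.
case: (exec_while (e := search_test) (p := search_body) (I := I) _ _ Is) => //.
  move=> {Is} {}m {}s [{}o [{}p [{}k {}Ss]]].
  rewrite /= eqb0 negbK (ss_tail Ss) => lt_h.
  have [Ss' h_s' u_s' rep_s'] := search_mark_state Ss lt_h.
  rewrite -h_s' in lt_h u_s' rep_s'.
  have [o' [p' [k' [Ss'' m_gt0]]]] := search_scan_state Ss' lt_h u_s' rep_s'.
  by exists m.-1; [rewrite prednK | exists o', p', k'].
move=> t [s' [m' [X le_t [o' [p' [k' Ss']]]]]] /eqP.
rewrite /= eqb0 (ss_tail Ss') -leqNgt => ge_h.
exists t, s', m', o', p', k'; split=> //; apply/eqP.
by rewrite eqn_leq ge_h (s_head (ss_search Ss')).
Qed.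

End SearchPhase.

(** * The labelling phase *)

Definition test_degree : com :=
  If (Eq (Defs.Sub (Read 0 (Succ (Reg 8))) (Read 0 (Reg 8))) (Const 1))
    (Write 7 (Reg 8) (Const 1)) Skip.

Definition test_conflict : com :=
  If (Read 7 (Reg 8)) (If (Read 8 (Reg 8)) (Assign 10 (Const 1)) Skip) Skip.

Definition push_A : com :=
  If (Read 8 (Reg 8)) Skip (Write 9 (Reg 9) (Succ (Reg 8))).

Definition push_B : com :=
  If (Read 7 (Reg 8)) Skip
    (If (Read 8 (Reg 8)) (Write 10 (Reg 9) (Succ (Reg 8)))
       (If (Read 10 (Reg 9)) Skip (Write 10 (Reg 9) (Succ (Reg 8))))).

Definition close_A : com := If (Read 9 (Reg 8)) Skip (Write 7 (Reg 9) (Const 1)).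

Definition close_B : com := If (Read 10 (Reg 8)) Skip (Write 8 (Reg 9) (Const 1)).

(** Register 7 counts down, so that children come before their parents and a representative comes
    last in its class; there its block is closed. *)
Definition label_body : com :=
  Assign 7 (Defs.Sub (Reg 7) (Const 1)) ;;
  Assign 8 (Read 4 (Reg 7)) ;;
  test_degree ;;
  test_conflict ;;
  If (Reg 7)
    (Assign 9 (Defs.Sub (Read 6 (Reg 8)) (Const 1)) ;;
     push_A ;;
     push_B ;;
     If (Eq (Reg 9) (Reg 8))
       (Assign 9 (Defs.Sub (Read 5 (Reg 8)) (Const 1)) ;; close_A ;; close_B) Skip)
    Skip.

Definition code n (w : option 'I_n) : nat := if w is Some x then x.+1 else 0.

Section LabelPhase.
Variables (n : nat) (G : sgraph 'I_n) (L : 'I_n -> seq 'I_n) (r : 'I_n).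
Variables (idx : 'I_n -> nat) (p rho : 'I_n -> 'I_n).
Hypotheses (LP : adjacency_lists G L) (bt : block_tree G r idx p rho).
Hypothesis idx_root : idx r = 0.
Hypothesis idx_surj : forall i, i < n -> exists v, idx v = i.
Implicit Types (MA MB : 'I_n -> bool) (CA CB : 'I_n -> option 'I_n) (ok : bool).

Record labelled (s : state) MA MB CA CB ok : Prop := Labelled {
  l_n : regs s 0 = n;
  l_offsets : arr s 0 = nth 0 (offsets L);
  l_ord : forall v, arr s 4 (idx v) = v;
  l_par : forall v, v != r -> arr s 5 v = (p v).+1;
  l_rep : forall v, v != r -> arr s 6 v = (rho v).+1;
  l_A : forall v : 'I_n, arr s 7 v = MA v;
  l_B : forall v : 'I_n, arr s 8 v = MB v;
  l_CA : forall v : 'I_n, arr s 9 v = code (CA v);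
  l_CB : forall v : 'I_n, arr s 10 v = code (CB v);
  l_ok : regs s 10 = ~~ ok }.

(** Register 10, the failure flag, is the only register that the fragments below may change. *)
Definition same_regs (s s' : state) := forall j, j != 10 -> regs s' j = regs s j.

Lemma labelled_A s MA MB CA CB ok (v : 'I_n) : labelled s MA MB CA CB ok ->
  labelled (set_mem s 7 v 1) (set_at MA v true) MB CA CB ok.
Proof. by case=> *; split=> //= w; rewrite /update /= val_eqE /set_at; case: eqP. Qed.

Lemma labelled_B s MA MB CA CB ok (v : 'I_n) : labelled s MA MB CA CB ok ->
  labelled (set_mem s 8 v 1) MA (set_at MB v true) CA CB ok.
Proof. by case=> *; split=> //= w; rewrite /update /= val_eqE /set_at; case: eqP. Qed.

Lemma labelled_CA s MA MB CA CB ok (x v : 'I_n) : labelled s MA MB CA CB ok ->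
  labelled (set_mem s 9 x v.+1) MA MB (set_at CA x (Some v)) CB ok.
Proof. by case=> *; split=> //= w; rewrite /update /= val_eqE /set_at; case: eqP. Qed.

Lemma labelled_CB s MA MB CA CB ok (x v : 'I_n) : labelled s MA MB CA CB ok ->
  labelled (set_mem s 10 x v.+1) MA MB CA (set_at CB x (Some v)) ok.
Proof. by case=> *; split=> //= w; rewrite /update /= val_eqE /set_at; case: eqP. Qed.

Lemma labelled_reg s MA MB CA CB ok j a : labelled s MA MB CA CB ok ->
  j != 0 -> j != 10 -> labelled (set_reg s j a) MA MB CA CB ok.
Proof.
move=> lab /negPf j0 /negPf j10; case: lab => *.
by split=> //=; rewrite /update eq_sym ?j0 ?j10.
Qed.

Lemma run_test_degree s MA MB CA CB ok (v : 'I_n) :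
    labelled s MA MB CA CB ok -> regs s 8 = v ->
  labelled (run test_degree s)
    (if degree G v == 1 then set_at MA v true else MA) MB CA CB ok
  /\ same_regs s (run test_degree s).
Proof.
move=> lab reg_v; rewrite /= reg_v (l_offsets lab) nth_offsetsS nth_offsets addKn.
rewrite (size_list LP) eqb0; case: eqP => _ /=; last by [].
by split=> //; apply: labelled_A.
Qed.

Lemma run_test_conflict s MA MB CA CB ok (v : 'I_n) :
    labelled s MA MB CA CB ok -> regs s 8 = v ->
  labelled (run test_conflict s) MA MB CA CB (ok && ~~ (MA v && MB v))
  /\ same_regs s (run test_conflict s).
Proof.
move=> lab reg_v; rewrite /= reg_v (l_A lab) (l_B lab) !eqb0.
case: (MA v) => /=; last by rewrite andbT.
case: (MB v) => /=; last by rewrite andbT.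
rewrite andbF; split; first by case: lab.
by move=> j /negPf j10; rewrite /= /update j10.
Qed.

Lemma run_push_A s MA MB CA CB ok (v x : 'I_n) :
    labelled s MA MB CA CB ok -> regs s 8 = v -> regs s 9 = x ->
  labelled (run push_A s) MA MB (if ~~ MB v then set_at CA x (Some v) else CA) CB ok
  /\ same_regs s (run push_A s).
Proof.
move=> lab reg_v reg_x; rewrite /= reg_v reg_x (l_B lab) eqb0.
by case: (MB v) => //=; split=> //; apply: labelled_CA.
Qed.

Lemma run_push_B s MA MB CA CB ok (v x : 'I_n) :
    labelled s MA MB CA CB ok -> regs s 8 = v -> regs s 9 = x ->
  labelled (run push_B s) MA MB CA
    (if ~~ MA v && (MB v || (CB x == None)) then set_at CB x (Some v) else CB) ok
  /\ same_regs s (run push_B s).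
Proof.
move=> lab reg_v reg_x; rewrite /= reg_v reg_x (l_A lab) (l_B lab) (l_CB lab) !eqb0.
case: (MA v) (MB v) => [] [] //=; try by split=> //; apply: labelled_CB.
by case: (CB x) => //=; split=> //; apply: labelled_CB.
Qed.

Lemma run_close_A s MA MB CA CB ok (v z : 'I_n) :
    labelled s MA MB CA CB ok -> regs s 8 = v -> regs s 9 = z ->
  labelled (run close_A s) (if CA v == None then set_at MA z true else MA) MB CA CB ok
  /\ same_regs s (run close_A s).
Proof.
move=> lab reg_v reg_x; rewrite /= reg_v reg_x (l_CA lab).
by case: (CA v) => //=; split=> //; apply: labelled_A.
Qed.

Lemma run_close_B s MA MB CA CB ok (v z : 'I_n) :
    labelled s MA MB CA CB ok -> regs s 8 = v -> regs s 9 = z ->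
  labelled (run close_B s) MA (if CB v == None then set_at MB z true else MB) CA CB ok
  /\ same_regs s (run close_B s).
Proof.
move=> lab reg_v reg_x; rewrite /= reg_v reg_x (l_CB lab).
by case: (CB v) => //=; split=> //; apply: labelled_B.
Qed.

Definition label_state i s := exists MA MB CA CB ok,
  [/\ labelled s MA MB CA CB ok, labels G r idx p rho i i MA MB CA CB ok & regs s 7 = i].

Lemma label_step i s : label_state i.+1 s -> i < n -> label_state i (run label_body s).
Proof.
move=> [MA [MB [CA [CB [ok [lab0 mlab reg_i]]]]]] /idx_surj[v def_i].
rewrite -{i}def_i in reg_i mlab *.
pose s1 := run (Assign 7 (Defs.Sub (Reg 7) (Const 1)) ;; Assign 8 (Read 4 (Reg 7))) s.
have [lab1 reg_i1 reg_v1] :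
    [/\ labelled s1 MA MB CA CB ok, regs s1 7 = idx v & regs s1 8 = v].
  rewrite /s1 /= /update /= reg_i subn1 /= (l_ord lab0); split=> //.
  by do 2 apply: labelled_reg => //.
pose s2 := run test_degree s1.
have [lab2 same2] : labelled s2 _ _ _ _ _ /\ _ := run_test_degree lab1 reg_v1.
set MA1 := (if _ then _ else _) in lab2.
have mlab2 : labels G r idx p rho (idx v).+1 (idx v).+1 MA1 MB CA CB ok.
  rewrite /MA1; case: eqP => // deg_v; apply: labels_setA => // chi valid.
  exact: valid.2.
have deg_v : degree G v = 1 -> MA1 v.
  by move=> deg_v; rewrite /MA1 deg_v eqxx /set_at eqxx.
have reg_v2 : regs s2 8 = v by rewrite same2.
pose s3 := run test_conflict s2.
have [lab3 same3] : labelled s3 _ _ _ _ _ /\ _ := run_test_conflict lab2 reg_v2.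
have reg_v3 : regs s3 8 = v by rewrite same3.
have reg_i3 : regs s3 7 = idx v by rewrite same3 // same2.
have -> : run label_body s = run (If (Reg 7)
    (Assign 9 (Defs.Sub (Read 6 (Reg 8)) (Const 1)) ;; push_A ;; push_B ;;
     If (Eq (Reg 9) (Reg 8))
       (Assign 9 (Defs.Sub (Read 5 (Reg 8)) (Const 1)) ;; close_A ;; close_B) Skip)
    Skip) s3 by [].
(* Position 0 is that of the root, so the test of register 7 singles out the root. *)
have idx0 : (idx v == 0) = (v == r) by rewrite -idx_root (inj_eq (bt_inj bt)).
have [v_r | v_r] := eqVneq v r.
  rewrite run_if [eval _ _]reg_i3 idx0 v_r eqxx.
  exists MA1, MB, CA, CB, (ok && ~~ (MA1 v && MB v)); split=> //; last by rewrite reg_i3 v_r.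
  apply: (labels_skip bt); last by left.
  by rewrite v_r in mlab2 deg_v *; apply: (labels_root bt).
set rest := (_ ;; _).
rewrite run_if [eval _ _]reg_i3 idx0 (negPf v_r).
pose s4 := run (Assign 9 (Defs.Sub (Read 6 (Reg 8)) (Const 1))) s3.
have lab4 : labelled s4 MA1 MB CA CB (ok && ~~ (MA1 v && MB v)) by apply: labelled_reg.
have reg_v4 : regs s4 8 = v by [].
have reg_i4 : regs s4 7 = idx v by [].
have reg_x4 : regs s4 9 = rho v by rewrite /s4 /= /update /= reg_v3 (l_rep lab3) // subn1.
pose s5 := run push_A s4.
have [lab5 same5] : labelled s5 _ _ _ _ _ /\ _ := run_push_A lab4 reg_v4 reg_x4.
have reg_v5 : regs s5 8 = v by rewrite same5.
have reg_x5 : regs s5 9 = rho v by rewrite same5.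
pose s6 := run push_B s5.
have [lab6 same6] : labelled s6 _ _ _ _ _ /\ _ := run_push_B lab5 reg_v5 reg_x5.
have reg_v6 : regs s6 8 = v by rewrite same6.
have reg_x6 : regs s6 9 = rho v by rewrite same6.
have reg_i6 : regs s6 7 = idx v by rewrite same6 // same5.
have mlab6 := labels_vertex bt mlab2 v_r deg_v.
set CA1 := (if _ then set_at CA _ _ else _) in lab6 mlab6.
set CB1 := (if _ then set_at CB _ _ else _) in lab6 mlab6.
have -> : run rest s3 = run (If (Eq (Reg 9) (Reg 8))
       (Assign 9 (Defs.Sub (Read 5 (Reg 8)) (Const 1)) ;; close_A ;; close_B) Skip) s6 by [].
have [rho_v | rho_v] := eqVneq (rho v) v; last first.
  exists MA1, MB, CA1, CB1, (ok && ~~ (MA1 v && MB v)).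
  rewrite run_if [eval _ _]/= reg_x6 reg_v6 val_eqE (negPf rho_v); split=> //.
  by apply: (labels_skip bt) => //; right.
set close := (_ ;; _).
have -> : run (If (Eq (Reg 9) (Reg 8)) close Skip) s6 = run close s6.
  by rewrite run_if [eval _ _]/= reg_x6 reg_v6 rho_v eqxx.
pose s7 := run (Assign 9 (Defs.Sub (Read 5 (Reg 8)) (Const 1))) s6.
have lab7 : labelled s7 MA1 MB CA1 CB1 (ok && ~~ (MA1 v && MB v)) by apply: labelled_reg.
have reg_v7 : regs s7 8 = v by [].
have reg_z7 : regs s7 9 = p v by rewrite /s7 /= /update /= reg_v6 (l_par lab6) // subn1.
pose s8 := run close_A s7.
have [lab8 same8] : labelled s8 _ _ _ _ _ /\ _ := run_close_A lab7 reg_v7 reg_z7.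
have reg_v8 : regs s8 8 = v by rewrite same8.
have reg_z8 : regs s8 9 = p v by rewrite same8.
have [lab9 same9] := run_close_B lab8 reg_v8 reg_z8.
have mlab9 := labels_block bt mlab6 v_r rho_v.
do 5!eexists; split; [exact: lab9 | exact: mlab9 | by rewrite same9 // same8].
Qed.

Definition label_test : expr := Lt (Const 0) (Reg 7).

Lemma label_phase s : label_state n s ->
  exists t s',
    [/\ exec (While label_test label_body) s t s',
        t <= while_cost label_test label_body * n.+1 & label_state 0 s'].
Proof.
move=> Ls; pose I i s := label_state i s /\ i <= n.
have Is : I n s by [].
case: (exec_while (e := label_test) (p := label_body) (I := I) _ _ Is) => //.
  move=> {Is} [|i] {}s [{}Ls le_i].
    by have [? [? [? [? [? [_ _ reg_i]]]]]] := Ls; rewrite [eval _ _]/= reg_i.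
  by exists i => //; split; [apply: label_step | apply: ltnW].
move=> t [s' [i [X le_t [Ls' _] /eqP e0]]]; exists t, s'; split=> //.
have [? [? [? [? [? [_ _ reg_i]]]]]] := Ls'.
by move: e0; rewrite /= reg_i eqb0 -leqNgt leqn0 => /eqP <-.
Qed.

End LabelPhase.

(** * The colouring phase *)

Definition pick_colour : com :=
  If (Read 11 (Reg 11))
    (Assign 12 (Defs.Sub (Read 9 (Reg 9)) (Const 1)))
    (If (Eq (Read 10 (Reg 9)) (Succ (Reg 8))) (Write 11 (Reg 8) (Const 1)) Skip ;;
     Assign 12 (Defs.Sub (Read 10 (Reg 9)) (Const 1))).

(** The root, at position 0, yields no edge, so the edge of the vertex at position [i] becomes entry
    [i - 1]. *)
Definition emit_edge : com :=
  Write 2 (Defs.Sub (Reg 7) (Const 1)) (Reg 8) ;;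
  If (Eq (Read 11 (Reg 8)) (Read 11 (Reg 11)))
    (Write 3 (Defs.Sub (Reg 7) (Const 1)) (Reg 12))
    (Write 3 (Defs.Sub (Reg 7) (Const 1)) (Reg 11)).

Definition colour_body : com :=
  Assign 8 (Read 4 (Reg 7)) ;;
  Write 11 (Reg 8) (Read 8 (Reg 8)) ;;
  If (Reg 7)
    (Assign 9 (Defs.Sub (Read 6 (Reg 8)) (Const 1)) ;;
     Assign 11 (Defs.Sub (Read 5 (Reg 8)) (Const 1)) ;;
     pick_colour ;;
     emit_edge)
    Skip ;;
  Assign 7 (Succ (Reg 7)).

Definition colour_test : expr := Lt (Reg 7) (Reg 0).

Section ColourPhase.
Variables (n : nat) (G : sgraph 'I_n) (L : 'I_n -> seq 'I_n) (r : 'I_n).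
Variables (idx : 'I_n -> nat) (p rho : 'I_n -> 'I_n).
Hypotheses (bt : block_tree G r idx p rho) (r0 : val r = 0).
Hypothesis idx_root : idx r = 0.
Hypothesis idx_surj : forall i, i < n -> exists v, idx v = i.
Variables (MA MB : 'I_n -> bool) (CA CB : 'I_n -> option 'I_n) (ok : bool).

(** The argument [k] is fuel for the recursion along parents; [(idx v).+1] is enough because indices
    decrease. *)
Fixpoint colour_iter k v :=
  if k is k'.+1 then
    MB v || [&& v != r, ~~ colour_iter k' (p v) & CB (rho v) == Some v]
  else false.

Definition colour v := colour_iter (idx v).+1 v.

Definition tree_parent v :=
  if colour v == colour (p v)
  then odflt r (if colour (p v) then CA (rho v) else CB (rho v)) else p v.

Lemma colour_root : colour r = MB r.
Proof. by rewrite /colour /= eqxx orbF. Qed.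

Lemma colourE v : v != r ->
  colour v = MB v || (~~ colour (p v) && (CB (rho v) == Some v)).
Proof.
have iterE k l w : idx w < k -> idx w < l -> colour_iter k w = colour_iter l w.
  elim: k l w => // k IH [|l] w //=; rewrite !ltnS => lt_k lt_l.
  case: eqP => //= /eqP/(bt_parent bt)[_ lt_p].
  by rewrite (IH l) // (leq_trans lt_p).
move=> v_r; rewrite {1}/colour /= v_r /=.
by rewrite (iterE _ (idx (p v)).+1) //; case: (bt_parent bt v_r).
Qed.

Notation labelled := (labelled L r idx p rho).

Lemma labelled_arr s a i x : labelled s MA MB CA CB ok -> a \in [:: 2; 3; 11] ->
  labelled (set_mem s a i x) MA MB CA CB ok.
Proof. by move=> lab; rewrite !inE => /or3P[] /eqP->; case: lab => *; split. Qed.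

Lemma run_pick_colour s (v z x : 'I_n) (c : bool) :
    labelled s MA MB CA CB ok -> regs s 8 = v -> regs s 9 = x -> regs s 11 = z ->
    arr s 11 v = MB v -> arr s 11 z = c ->
  let s' := run pick_colour s in
  [/\ labelled s' MA MB CA CB ok,
      arr s' 11 v = MB v || (~~ c && (CB x == Some v)),
      forall w : 'I_n, w != v -> arr s' 11 w = arr s 11 w,
      regs s' 12 = odflt r (if c then CA x else CB x)
    & (forall j, j != 12 -> regs s' j = regs s j) /\
      (arr s' 2 = arr s 2 /\ arr s' 3 = arr s 3)].
Proof.
(* Truncated subtraction sends the code 0 of [None] to 0, which is the number of the root and
   matches the default. *)
have odfltE (w : option 'I_n) : code w - 1 = odflt r w.
  by case: w => [w|] /=; rewrite ?subn1 ?r0.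
have same_reg a j : j != 12 -> update (regs s) 12 a j = regs s j.
  by rewrite /update => /negPf->.
move=> lab reg_v reg_x reg_z arr_v arr_z; rewrite /= reg_z arr_z eqb0.
case: c arr_z => /= arr_z.
  rewrite reg_x (l_CA lab) odfltE orbF; split=> //; first exact: labelled_reg.
  by split=> // j; apply: same_reg.
have codeE : (code (CB x) == v.+1) = (CB x == Some v).
  by case: (CB x) => [w|//] /=; rewrite eqSS val_eqE.
rewrite reg_x reg_v (l_CB lab) eqb0 codeE; case: (CB x =P Some v) => /= [Cx | _].
  rewrite reg_x [update (arr s) _ _ 10 _](l_CB lab) odfltE; split=> //.
  - by apply: labelled_reg => //; apply: labelled_arr.
  - by rewrite /update /= eqxx orbT.
  - by move=> w neq_wv; rewrite /update /= val_eqE (negPf neq_wv).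
  - by split=> // j; apply: same_reg.
rewrite reg_x (l_CB lab) odfltE orbF; split=> //; first exact: labelled_reg.
by split=> // j; apply: same_reg.
Qed.

Lemma run_emit_edge s (v z a : 'I_n) i (c d : bool) :
    labelled s MA MB CA CB ok -> regs s 7 = i.+1 -> regs s 8 = v ->
    regs s 11 = z -> regs s 12 = a -> arr s 11 v = c -> arr s 11 z = d ->
  let s' := run emit_edge s in
  [/\ labelled s' MA MB CA CB ok, regs s' = regs s, arr s' 11 = arr s 11,
      arr s' 2 = update (arr s 2) i v
    & arr s' 3 = update (arr s 3) i (if c == d then a else z)].
Proof.
move=> lab reg_i reg_v reg_z reg_a arr_v arr_z.
have eq_cd : ((c : nat) == d) = (c == d) by case: (c) (d) => [] [].
rewrite /= /update /= reg_i reg_v reg_z arr_v arr_z eqb0 eq_cd.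
by case: (c == d) => /=; rewrite subn1 ?reg_a; split=> //; do 2 apply: labelled_arr => //.
Qed.

Record coloured i s : Prop := Coloured {
  c_labelled : labelled s MA MB CA CB ok;
  c_reg : regs s 7 = i;
  c_colour : forall v : 'I_n, idx v < i -> arr s 11 v = colour v;
  c_child : forall v : 'I_n, v != r -> idx v < i -> arr s 2 (idx v).-1 = v;
  c_parent : forall v : 'I_n, v != r -> idx v < i ->
    arr s 3 (idx v).-1 = tree_parent v }.

Lemma colour_step i s : coloured i s -> i < n -> coloured i.+1 (run colour_body s).
Proof.
move=> [lab reg_i arr_col arr_2 arr_3] /idx_surj[v def_i].
have lt_iS w : idx w < i.+1 -> w = v \/ idx w < i /\ w != v.
  rewrite ltnS leq_eqVlt -def_i (inj_eq (bt_inj bt)) => /orP[/eqP | lt_w]; first by left.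
  by right; split=> //; apply: contraTneq lt_w => ->; rewrite ltnn.
have idx0 : (i == 0) = (v == r) by rewrite -def_i -idx_root (inj_eq (bt_inj bt)).
pose s1 := run (Assign 8 (Read 4 (Reg 7)) ;; Write 11 (Reg 8) (Read 8 (Reg 8))) s.
have [lab1 reg_i1 reg_v1] :
    [/\ labelled s1 MA MB CA CB ok, regs s1 7 = i & regs s1 8 = v].
  rewrite /s1 /= /update /= reg_i -def_i (l_ord lab); split=> //.
  by apply: labelled_arr => //; apply: labelled_reg.
have arr_v1 : arr s1 11 v = MB v.
  by rewrite /s1 /= /update /= reg_i -def_i (l_ord lab) eqxx (l_B lab).
have arr_w1 (w : 'I_n) : w != v -> arr s1 11 w = arr s 11 w.
  move=> neq_wv; rewrite /s1 /= /update /= reg_i -def_i (l_ord lab).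
  by rewrite val_eqE (negPf neq_wv).
have -> : run colour_body s = run (Assign 7 (Succ (Reg 7))) (run (If (Reg 7)
    (Assign 9 (Defs.Sub (Read 6 (Reg 8)) (Const 1)) ;;
     Assign 11 (Defs.Sub (Read 5 (Reg 8)) (Const 1)) ;; pick_colour ;; emit_edge) Skip) s1) by [].
have arr_21 : arr s1 2 = arr s 2 by [].
have arr_31 : arr s1 3 = arr s 3 by [].
clearbody s1; rewrite run_if [eval _ _]reg_i1 idx0.
have [v_r | v_r] := eqVneq v r.
  rewrite /= reg_i1; split=> //=.
  - exact: labelled_reg.
  - move=> w /lt_iS[-> | [lt_w neq_w]]; first by rewrite arr_v1 v_r colour_root.
    by rewrite arr_w1 // arr_col.
  - move=> w w_r /lt_iS[w_v | [lt_w _]]; last by rewrite arr_21 arr_2.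
    by rewrite w_v v_r eqxx in w_r.
  move=> w w_r /lt_iS[w_v | [lt_w _]]; last by rewrite arr_31 arr_3.
  by rewrite w_v v_r eqxx in w_r.
have [_ lt_p] := bt_parent bt v_r.
have neq_pv : p v != v by apply: contraTneq lt_p => ->; rewrite ltnn.
pose s2 := run (Assign 9 (Defs.Sub (Read 6 (Reg 8)) (Const 1)) ;;
     Assign 11 (Defs.Sub (Read 5 (Reg 8)) (Const 1))) s1.
have lab2 : labelled s2 MA MB CA CB ok by do 2 apply: labelled_reg => //.
have reg_x2 : regs s2 9 = rho v.
  by rewrite /s2 /= /update /= reg_v1 (l_rep lab1) // subn1.
have reg_z2 : regs s2 11 = p v.
  by rewrite /s2 /= /update /= reg_v1 (l_par lab1) // subn1.
have arr_z2 : arr s2 11 (p v) = colour (p v).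
  by rewrite [LHS]arr_w1 // arr_col // -def_i.
have [] := run_pick_colour lab2 reg_v1 reg_x2 reg_z2 arr_v1 arr_z2.
set s3 := run pick_colour s2 => lab3 arr_v3 arr_w3 reg_a3 [same3 [arr_23 arr_33]].
rewrite -colourE // in arr_v3.
have reg_i3 : regs s3 7 = (idx v).-1.+1.
  by rewrite same3 // [LHS]reg_i1 prednK // def_i lt0n idx0.
have reg_v3 : regs s3 8 = v by rewrite same3.
have reg_z3 : regs s3 11 = p v by rewrite same3.
have arr_z3 : arr s3 11 (p v) = colour (p v) by rewrite arr_w3.
have [] := run_emit_edge lab3 reg_i3 reg_v3 reg_z3 reg_a3 arr_v3 arr_z3.
have -> : run (Assign 9 (Defs.Sub (Read 6 (Reg 8)) (Const 1)) ;;
     Assign 11 (Defs.Sub (Read 5 (Reg 8)) (Const 1)) ;; pick_colour ;; emit_edge) s1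
   = run emit_edge s3 by [].
move: (run emit_edge s3) => s4 lab4 reg_4 arr_4 arr_24 arr_34.
(* Off the root, the truncated predecessor is injective on positions, so the new entry overwrites no
   earlier one. *)
have idx_pred w : w != v -> w != r -> ((idx w).-1 == (idx v).-1) = false.
  move=> neq_w w_r; apply: contraNF neq_w => /eqP eq_idx; apply/eqP/(bt_inj bt).
  have pos u : u != r -> idx u = (idx u).-1.+1.
    move=> u_r; rewrite prednK // lt0n -idx_root.
    by rewrite (inj_eq (bt_inj bt)).
  by rewrite (pos w) // (pos v) // eq_idx.
split=> /=.
- exact: labelled_reg.
- by rewrite /update /= reg_4 same3 // [regs s2 7]reg_i1.
- rewrite arr_4 => w /lt_iS[-> // | [lt_w neq_w]].
  by rewrite arr_w3 // [LHS]arr_w1 // arr_col.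
- rewrite arr_24 /update => w w_r /lt_iS[-> | [lt_w neq_w]]; first by rewrite eqxx.
  by rewrite idx_pred // arr_23 [arr s2 2]arr_21 arr_2.
rewrite arr_34 /update => w w_r /lt_iS[-> | [lt_w neq_w]].
  by rewrite eqxx /tree_parent; case: eqP.
by rewrite idx_pred // arr_33 [arr s2 3]arr_31 arr_3.
Qed.

Lemma colour_phase s : coloured 0 s ->
  exists t s',
    [/\ exec (While colour_test colour_body) s t s',
        t <= while_cost colour_test colour_body * n.+1 & coloured n s'].
Proof.
move=> Cs; pose I m s := exists2 i, coloured i s & m + i = n.
have Is : I n s by exists 0; rewrite ?addn0.
case: (exec_while (e := colour_test) (p := colour_body) (I := I) _ _ Is) => //.
  move=> {Is} m {}s [i {}Cs sum_i].
  rewrite [eval _ _]/= (c_reg Cs) (l_n (c_labelled Cs)) eqb0 negbK => lt_i.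
  exists m.-1; first by move: sum_i lt_i; clear; lia.
  by exists i.+1; [apply: colour_step | move: sum_i lt_i; clear; lia].
move=> t [s' [m [X le_t [i Cs' sum_i] e0]]]; exists t, s'; split=> //.
move: e0; rewrite /= (c_reg Cs') (l_n (c_labelled Cs')) => /eqP.
rewrite eqb0 -leqNgt => ge_i.
by have <- : i = n by move: sum_i ge_i; clear; lia.
Qed.

End ColourPhase.

(** * Edge lists and the complete program *)

(** Two vertices that give the same edge would be each other's parent, against the decrease of
    ranks. *)
Lemma parent_edge_list n (T : sgraph 'I_n) r q (rk : 'I_n -> nat) (s : seq 'I_n) :
    (forall v, v != r -> rk (q v) < rk v) -> T =2 parent_rel r q ->
    uniq s -> (forall v, (v \in s) = (v != r)) ->
  edge_list T [seq (val v, val (q v)) | v <- s].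
Proof.
move=> rkP eqT uniq_s mem_s; exists [seq (v, q v) | v <- s].
rewrite -!map_comp; split=> //.
  rewrite map_inj_in_uniq // => v w; rewrite !mem_s => v_r w_r /= eq_vw.
  apply/eqP/negPn/negP => neq_vw.
  have: v \in [set w; q w] by rewrite -eq_vw !inE eqxx.
  have: w \in [set v; q v] by rewrite eq_vw !inE eqxx.
  rewrite !inE eq_sym (negPf neq_vw) /= => /eqP w_q /eqP v_q.
  by have := rkP v v_r; have := rkP w w_r; rewrite -w_q -v_q; clear; lia.
move=> e; apply/mapP/imsetP => [[v vs ->] | [[x y] Txy ->]] /=.
  exists (v, q v) => //; rewrite inE /= eqT /parent_rel /=.
  by move: vs; rewrite mem_s => ->; rewrite eqxx.
move: Txy; rewrite inE /= eqT /parent_rel /= => /orP[] /andP[x_r /eqP <-].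
  by exists x; rewrite ?mem_s.
by exists y; rewrite ?mem_s // setUC.
Qed.

Definition label_and_colour : com :=
  Assign 7 (Reg 0) ;;
  While label_test label_body ;;
  If (Reg 10) (Assign 0 (Const 0))
    (While colour_test colour_body ;; Assign 1 (Defs.Sub (Reg 0) (Const 1))).

Definition even_tree_program : com :=
  If (Reg 0)
    (Write 5 (Const 0) (Succ (Reg 0)) ;;
     Assign 3 (Const 1) ;;
     While search_test search_body ;;
     If (Lt (Reg 3) (Reg 0)) (Assign 0 (Const 0)) label_and_colour)
    Skip.

Definition correct_output n (G : sgraph 'I_n) (s : state) : Prop :=
  match output s with
  | Some es => exists T : sgraph 'I_n, spanning_even_tree G T /\ edge_list T es
  | None => ~ exists T : sgraph 'I_n, spanning_even_tree G T
  end.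

Section Program.
Variables (n : nat) (G : sgraph 'I_n) (L : 'I_n -> seq 'I_n) (r : 'I_n).
Hypotheses (bG : block_graph G) (LP : adjacency_lists G L) (r0 : val r = 0).

(** The queue without its head, the root, lists the remaining vertices in the order in which their
    edges were written. *)
Lemma coloured_output o p rho MA MB CA CB s :
    block_tree G r (index^~ o) p rho -> uniq o -> size o = n -> index r o = 0 ->
    (forall v, v \in o) ->
    labels G r (index^~ o) p rho 0 0 MA MB CA CB true ->
    coloured L r (index^~ o) p rho MA MB CA CB true n s ->
  correct_output G (set_reg s 1 (n - 1)).
Proof.
move=> bt uniq_o sz_o idx_r mem_o mlab [lab _ _ arr_2 arr_3].
have n_gt0 : 0 < n by apply: leq_ltn_trans (ltn_ord r).
set col := colour r (index^~ o) p rho MB CB.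
set q := tree_parent r (index^~ o) p rho MB CA CB.
have colE v (v_r : v != r) := colourE bt MB CB v_r.
have col_root : col r = MB r := colour_root _ _ _ _ _ _.
have qE v : v != r -> q v = if col v == col (p v)
    then odflt r (if col (p v) then CA (rho v) else CB (rho v)) else p v by [].
have [T eqT evenT] := coloured_tree bt mlab col_root colE qE.
have rkP := tree_rank_q bt mlab col_root colE qE.
rewrite /correct_output /output /= /update /= (l_n lab) eqn0Ngt n_gt0 /=.
exists T; split=> //.
case: o => [|r' o] in bt uniq_o sz_o idx_r mem_o mlab lab arr_2 arr_3 col q colE col_root qE eqT evenT rkP *.
  by have := mem_o r.
have r'_r : r' = r by move: idx_r => /=; case: eqP.
case/andP: (uniq_o); rewrite r'_r => r_o uniq_o'.
have sz_o' : size o = n - 1 by rewrite subn1 -(congr1 predn sz_o).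
have -> : [seq (arr s 2 i, arr s 3 i) | i <- iota 0 (n - 1)] =
    [seq (val v, val (q v)) | v <- o].
  apply: (@eq_from_nth _ (0, 0)); first by rewrite !size_map size_iota sz_o'.
  move=> i; rewrite size_map size_iota => lt_i.
  rewrite (nth_map 0) ?size_iota // nth_iota // add0n.
  rewrite (nth_map r) ?sz_o' //; set v := nth r o i.
  have v_o : v \in o by rewrite mem_nth ?sz_o'.
  have v_r : v != r by apply: contraNneq r_o => <-.
  have idx_v : index v (r' :: o) = i.+1.
    by rewrite /= r'_r eq_sym (negPf v_r) index_uniq ?sz_o'.
  have lt_v : index v (r' :: o) < n by move: (index_mem v (r' :: o)); rewrite sz_o mem_o.
  have a2 := arr_2 v v_r lt_v; have a3 := arr_3 v v_r lt_v.
  by rewrite idx_v /= in a2 a3; rewrite a2 a3.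
apply: parent_edge_list rkP eqT uniq_o' _ => v.
have := mem_o v; rewrite inE r'_r; case: eqP => [-> _ | //]; exact: negPf.
Qed.

Lemma exec_label_and_colour o p rho s :
    block_tree G r (index^~ o) p rho -> uniq o -> size o = n -> index r o = 0 ->
    (forall v, v \in o) ->
    labelled L r (index^~ o) p rho s
      (fun=> false) (fun=> false) (fun=> None) (fun=> None) true ->
  exists t s',
    [/\ exec label_and_colour s t s',
        t <= (while_cost label_test label_body
              + while_cost colour_test colour_body + 20) * n.+1
      & correct_output G s'].
Proof.
move=> bt uniq_o sz_o idx_r mem_o lab.
have idx_lt v : index v o < n by rewrite -[X in _ < X]sz_o index_mem.
have idx_surj i : i < n -> exists v, index v o = i.
  by move=> lt_i; exists (nth r o i); rewrite index_uniq ?sz_o.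
have n_gt0 : 0 < n by apply: leq_ltn_trans (ltn_ord r).
pose s1 := run (Assign 7 (Reg 0)) s.
have Ls1 : label_state G L r (index^~ o) p rho n s1.
  exists (fun=> false), (fun=> false), (fun=> None), (fun=> None), true; split.
  - exact: labelled_reg.
  - exact: labels_init.
  - exact: l_n lab.
have [t2 [s2 [X2 le_t2 [MA [MB [CA [CB [ok [lab2 mlab2 reg_2]]]]]]]]] :=
  label_phase LP bt idx_r idx_surj Ls1.
have start t3 s3 : exec (If (Reg 10) (Assign 0 (Const 0))
    (While colour_test colour_body ;; Assign 1 (Defs.Sub (Reg 0) (Const 1)))) s2 t3 s3 ->
    exec label_and_colour s ((cost (Reg 0)).+1 + (t2 + t3).+1).+1 s3.
  by move=> X3; apply: ExecSeq (ExecAssign _ _ _) (ExecSeq X2 X3).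
(* Failure excludes valid colourings, and a spanning even tree would provide one. *)
case: ok lab2 mlab2 => lab2 mlab2; last first.
  exists ((cost (Reg 0)).+1 + (t2 + (cost (Reg 10) + (cost (Const 0)).+1).+1).+1).+1.
  exists (set_reg s2 0 0); split.
  - apply/start/ExecIfTrue; last exact: ExecAssign.
    by rewrite /= (l_ok lab2).
  - by move: le_t2; clear; rewrite /=; nia.
  - case=> T /(spanning_even_tree_valid bt)[chi].
    exact: (lab_ok mlab2 : forall chi, ~ _).
have Cs2 : coloured L r (index^~ o) p rho MA MB CA CB true 0 s2 by split.
have [t3 [s3 [X3 le_t3 Cs3]]] := colour_phase bt r0 idx_r idx_surj Cs2.
exists ((cost (Reg 0)).+1 + (t2 + (cost (Reg 10)
  + (t3 + (cost (Defs.Sub (Reg 0) (Const 1))).+1).+1).+1).+1).+1.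
exists (set_reg s3 1 (n - 1)); split.
- apply/start/ExecIfFalse; first by rewrite /= (l_ok lab2).
  by apply: ExecSeq X3 _; rewrite -(l_n (c_labelled Cs3)); apply: ExecAssign.
- by move: le_t2 le_t3; clear; rewrite /=; nia.
exact: coloured_output Cs3.
Qed.

(** The search has a budget of [n + arcs L], and the arcs are at most twice the edges; the factor 3
    and the constant 40 leave room for this and for the statements outside the loops. *)
Lemma exec_even_tree_program :
  exists t s,
    [/\ exec even_tree_program (input L) t s,
        t <= 3 * (while_cost search_test search_body
              + while_cost label_test label_body
              + while_cost colour_test colour_body + 40) * (n + #|edges G|).+1
      & correct_output G s].
Proof.
have n_gt0 : 0 < n by apply: leq_ltn_trans (ltn_ord r).
have r0' : nat_of_ord r = 0 := r0.
pose s1 := run (Write 5 (Const 0) (Succ (Reg 0)) ;; Assign 3 (Const 1)) (input L).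
have Ss1 : search_state G L r (n + arcs L) [:: r] (fun=> r) 0 s1.
  split=> //=.
  - by have := search_init G L r0; rewrite r0'.
  - by move=> _; rewrite addn0 -nth_offsets r0' nth_mkseq // big_pred0.
  - by split=> // a i; case: a => [|[|[|[|[|[|[|a]]]]]]].
  - by rewrite !addn0.
have [t2 [s2 [m' [o [p [k [X2 le_t2 Ss2 head2]]]]]]] := search_phase bG LP Ss1.
have [S sn st _ so _ [sf sc] _] := Ss2; rewrite head2 in S.
have start t3 s3 :
    exec (If (Lt (Reg 3) (Reg 0)) (Assign 0 (Const 0)) label_and_colour) s2 t3 s3 ->
    exec even_tree_program (input L)
      (1 + ((3).+1 + (2 + (t2 + t3).+1).+1).+1).+1 s3.
  move=> X3; apply: ExecIfTrue; first by rewrite /= -lt0n.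
  by apply: ExecSeq (ExecWrite _ _ _ _) (ExecSeq (ExecAssign _ _ _) (ExecSeq X2 X3)).
have le_arcs := arcs_le_edges LP.
have le_o : size o <= n.
  by rewrite -(card_uniqP (s_uniq S)) -[leqRHS]card_ord max_card.
(* The search misses a vertex only if the graph is disconnected, and then the answer is no. *)
have [sz_o | sz_o] := eqVneq (size o) n; last first.
  exists (1 + ((3).+1 + (2 + (t2 + (3 + 2).+1).+1).+1).+1).+1, (set_reg s2 0 0); split.
  - apply/start/ExecIfTrue; last exact: ExecAssign.
    by rewrite /= st sn ltn_neqAle sz_o le_o.
  - by move: le_t2 le_arcs; clear; nia.
  - exact: search_disconnected S erefl sz_o.
have [rho [bt repP]] := search_block_tree bG S erefl sz_o.
have mem_o := mem_uniq_ord (s_uniq S) sz_o.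
have lab : labelled L r (index^~ o) p rho s2
    (fun=> false) (fun=> false) (fun=> None) (fun=> None) true.
  split=> // [v|v v_r|v|v|v|v]; try exact: sc.
    by rewrite (s_ord S) ?index_mem // nth_index.
  by rewrite (s_par S) mem_o (negPf v_r).
have [t3 [s3 [X3 le_t3 out3]]] :=
  exec_label_and_colour bt (s_uniq S) sz_o (s_root S).2 mem_o lab.
exists (1 + ((3).+1 + (2 + (t2 + (3 + t3).+1).+1).+1).+1).+1, s3; split=> //.
- by apply/start/ExecIfFalse => //; rewrite /= st sn sz_o ltnn.
by move: le_t2 le_t3 le_arcs; clear; nia.
Qed.

End Program.

(* The successor in the time bound only matters for the graph without vertices. *)
Theorem theorem15 :
  exists (p : com) (c : nat),
  forall (n : nat) (G : sgraph 'I_n) (L : 'I_n -> seq 'I_n),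
    block_graph G -> adjacency_lists G L ->
    exists (t : nat) (s : state),
      [/\ exec p (input L) t s,
          t <= c * (n + #|edges G|).+1
        & match output s with
          | Some es =>
              exists T : sgraph 'I_n, spanning_even_tree G T /\ edge_list T es
          | None => ~ exists T : sgraph 'I_n, spanning_even_tree G T
          end].
Proof.
exists even_tree_program; eexists => n G L bG LP.
(* Without vertices there is no root to start from. The program then stops after 3 steps with
   register 0 still 0, which answers no, as trees are nonempty. *)
case: n G L bG LP => [|n] G L bG LP; last exact: (exec_even_tree_program (r := ord0)).
exists 3, (input L); split.
- by apply: ExecIfFalse => //; constructor.
- by rewrite -mulnA leq_pmulr // muln_gt0 addn_gt0 orbT.
- by case=> T [_ [[+ _ _] _]]; rewrite card_ord.
Qed.
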